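(* Let $n,N\ge1$. The elements $x^{i\alpha}$ and $\bar\partial_{j\beta}=\partial_{j\beta}\varphi_j$ ($1\le i,j\le n$, $1\le\alpha,\beta\le N$) of the reduction algebra $\mathrm{Diff}_{\mathbf h}(n,N)$ satisfy the following relations for all $i,j,\alpha,\beta$: $$x^{i\alpha}\diamond x^{j\beta}=\sum_{k,l}\hat R^{ij}_{kl}\,x^{k\beta}\diamond x^{l\alpha},\qquad \bar\partial_{i\alpha}\diamond\bar\partial_{j\beta}=\sum_{k,l}\hat R^{lk}_{ji}\,\bar\partial_{k\beta}\diamond\bar\partial_{l\alpha},$$ $$x^{i\alpha}\diamond\bar\partial_{j\beta}=\sum_{k,l}\hat R^{ki}_{lj}[\varepsilon_k]\,\bar\partial_{k\beta}\diamond x^{l\alpha}-\delta^\alpha_\beta\delta^i_j .$$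
   Context: Notation. Let $\mathfrak g=\mathfrak{gl}_n$ over $\mathbb C$ with standard basis $e_{ij}$, $[e_{ij},e_{kl}]=\delta_{jk}e_{il}-\delta_{il}e_{kj}$. Let $\mathfrak h$ be the Cartan subalgebra spanned by $h_i=e_{ii}$, $\mathfrak n_+$ (resp. $\mathfrak n_-$) the span of $e_{ij}$ with $i<j$ (resp. $i>j$), $\varepsilon_i\in\mathfrak h^*$ with $\varepsilon_i(h_j)=\delta_{ij}$. Put $h_{ij}=h_i-h_j$, $\tilde h_i=h_i-i$, $\tilde h_{ij}=\tilde h_i-\tilde h_j$. $\bar U(\mathfrak h)$ is the localization of $U(\mathfrak h)$ at the multiplicative set generated by the $h_{ij}+k$, $i\ne j$, $k\in\mathbb Z$; $\bar U(\mathfrak g)$ is the localization of $U(\mathfrak g)$ at the same set. For $f\in\bar U(\mathfrak h)$ and $\alpha\in\mathfrak h^*$, $f[\alpha]$ is the image of $f$ under the shift automorphism $h\mapsto h+\alpha(h)$; so $h_i[\varepsilon_j]=h_i+\delta_{ij}$. Reduction algebra. Let $\mathcal A$ be an associative algebra containing $U(\mathfrak g)$, with locally finite adjoint action of $\mathfrak g$, free as a left $U(\mathfrak h)$-module and with semisimple adjoint action of $\mathfrak h$; let $\bar{\mathcal A}=\mathcal A\otimes_{U(\mathfrak h)}\bar U(\mathfrak h)$. The reduction algebra is the double coset space $\tilde{\mathcal A}=\bar{\mathcal A}/(\mathfrak n_-\bar{\mathcal A}+\bar{\mathcal A}\mathfrak n_+)$ with the associative multiplication $x\diamond y=xPy$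 (class of), where $P$ is the extremal projector, the element of the standard completion of $\bar U(\mathfrak g)$ by formal series with $xP=0$ for $x\in\mathfrak n_+$, $Py=0$ for $y\in\mathfrak n_-$, $P\equiv 1$ modulo $\mathfrak n_-\bar U(\mathfrak g)$ and modulo $\bar U(\mathfrak g)\mathfrak n_+$, $P^2=P$. It is a $\bar U(\mathfrak h)$-bimodule, with multiplication by elements of $\bar U(\mathfrak h)$ the usual one. Let $\mathrm{Diff}(n,N)$ be the algebra of polynomial differential operators in the $nN$ variables $x^{i\alpha}$, with derivatives $\partial_{j\beta}=\partial/\partial x^{j\beta}$, and $\psi_N:U(\mathfrak g)\to\mathrm{Diff}(n,N)$, $\psi_N(e_{ij})=\sum_\alpha x^{i\alpha}\partial_{j\alpha}$. $\mathrm{Diff}_{\mathbf h}(n,N)$ is the reduction algebra of $\mathrm{Diff}(n,N)\otimes U(\mathfrak g)$ with respect to the diagonal embedding $X\mapsto\psi_N(X)\otimes1+1\otimes X$ of $\mathfrak g$ ($\bar U(\mathfrak h)$ refers to this diagonal copy). The classes of $x^{i\alpha}\otimes1$ and $\partial_{j\beta}\otimes1$ are denoted by $x^{i\alpha}$, $\partial_{j\beta}$. Put $\varphi_j=\prod_{k>j}\dfrac{\tilde h_{jk}}{\tilde h_{jk}-1}$. The matrix $\hat R$ with entries in $\bar U(\mathfrak h)$ has as only nonzero entries $\hat R^{ij}_{ij}=1/\tilde h_{ij}$ for $i\ne j$, $\hat R^{ij}_{ji}=(\tilde h_{ij}^2-1)/\tilde h_{ij}^2$ for $i<j$, and $\hat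 R^{ij}_{ji}=1$ for $i\ge j$. *)

(* Defs.v *)
From HB Require Import structures.
From mathcomp Require Import all_boot all_order all_algebra generic_quotient.
From mathcomp Require Import boolp classical_sets reals complex.
From mathcomp Require Import mpoly.

Set Implicit Arguments.
Unset Strict Implicit.
Unset Printing Implicit Defensive.

Import GRing.Theory.
Local Open Scope ring_scope.
Local Open Scope quotient_scope.

(* Associative unital algebras over a field, as rings A with a central ring
   morphism F -> A.  The library's [algType] also carries the axiom 1 != 0,
   which for a quotient is a theorem (here PBW) and not part of the
   construction. *)
HB.mixin Record PzRing_isPzAlg (F : fieldType) A of GRing.PzRing A := {
  cst : F -> A;
  cstD : forall a b, cst (a + b) = cst a + cst b;
  cstM : forall a b, cst (a * b) = cst a * cst b;
  cst1 : cst 1 = 1;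
  cstC : forall a (u : A), cst a * u = u * cst a
}.
#[short(type="pzalgType")]
HB.structure Definition PzAlg (F : fieldType) :=
  {A of GRing.PzRing A & PzRing_isPzAlg F A}.

Lemma cst0 (F : fieldType) (A : pzalgType F) : cst 0 = 0 :> A.
Proof. by apply: (addrI (cst 0)); rewrite -cstD !addr0. Qed.

Definition algmap (F : fieldType) (A B : pzalgType F) (f : A -> B) : Prop :=
  [/\ forall u v, f (u + v) = f u + f v, forall u v, f (u * v) = f u * f v
    & forall a, f (cst a) = cst a].

Definition linmap (F : fieldType) (V : lmodType F) (A : pzalgType F)
    (f : V -> A) : Prop :=
  forall a u v, f (a *: u + v) = cst a * f u + f v.

(* The two-sided inverse of an invertible element, and 0 otherwise. *)
Definition rinv (A : pzRingType) (a : A) : A :=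
  xget 0 [set b : A | a * b = 1 /\ b * a = 1].

Lemma rinv_eq (A : pzRingType) (a b : A) : a * b = 1 -> b * a = 1 -> rinv a = b.
Proof.
move=> ab ba; apply: xget_unique => [|c [ac ca]]; first by split.
by rewrite -[c]mul1r -ba -mulrA ac mulr1.
Qed.

(* Presented algebras.  [uni C] is the algebra generated by a family
   [gen : X -> uni C] subject to the identities [C] (a conjunction of
   polynomial identities between the values of a family X -> A): two
   noncommutative polynomials in the generators are identified when they agree
   on every family satisfying [C]. *)
Section Presented.
Variables (F : fieldType) (X : Type).
Variable C : forall A : pzalgType F, (X -> A) -> Prop.

Inductive term : Type :=
| Gen of X | Cst of F | Opp of term | Add of term & term | Mul of term & term.

Fixpoint eval (A : pzalgType F) (f : X -> A) (t : term) : A :=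
  match t with
  | Gen x => f x
  | Cst a => cst a
  | Opp t => - eval f t
  | Add s t => eval f s + eval f t
  | Mul s t => eval f s * eval f t
  end.

HB.instance Definition _ := gen_eqMixin term.
HB.instance Definition _ := gen_choiceMixin term.

Definition agree (s t : term) : bool :=
  `[< forall (A : pzalgType F) (f : X -> A), C f -> eval f s = eval f t >].

Lemma agree_equiv : equiv_class_of agree.
Proof.
split=> [s|s t|t s u].
- by apply/asboolP.
- by apply/asboolP/asboolP => h A f Cf; rewrite (h A f Cf).
- by move=> /asboolP h1 /asboolP h2; apply/asboolP => A f Cf; rewrite h1 ?h2.
Qed.

Canonical agree_equivRel := EquivRelPack agree_equiv.

Definition uni : Type := {eq_quot agree}.
HB.instance Definition _ := Choice.on uni.

Definition cl (t : term) : uni := \pi_({eq_quot agree}) t.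
Definition rp (u : uni) : term := repr (u : {eq_quot agree}).
Definition gen (x : X) : uni := cl (Gen x).

Lemma rpK u : cl (rp u) = u. Proof. exact: reprK. Qed.

Lemma clP s t :
  (forall (A : pzalgType F) (f : X -> A), C f -> eval f s = eval f t) ->
  cl s = cl t.
Proof. by move=> h; apply/eqmodP/asboolP. Qed.

Lemma eval_rp (A : pzalgType F) (f : X -> A) t :
  C f -> eval f (rp (cl t)) = eval f t.
Proof.
move=> Cf; have : rp (cl t) = t %[mod {eq_quot agree}] by exact: reprK.
by move/eqmodP/asboolP; apply.
Qed.

Definition uadd u v := cl (Add (rp u) (rp v)).
Definition umul u v := cl (Mul (rp u) (rp v)).
Definition uopp u := cl (Opp (rp u)).
Definition ucst a := cl (Cst a).

Ltac solve_uni :=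
  repeat move=> ?; rewrite -[RHS]rpK; apply: clP => A f Cf;
  rewrite /uadd /umul /uopp /ucst /= ?eval_rp //= ?eval_rp //=.

Lemma uaddA : associative uadd.
Proof. by solve_uni; rewrite addrA. Qed.
Lemma uaddC : commutative uadd.
Proof. by solve_uni; rewrite addrC. Qed.
Lemma uadd0 : left_id (ucst 0) uadd.
Proof. by solve_uni; rewrite cst0 add0r. Qed.
Lemma uaddN : left_inverse (ucst 0) uopp uadd.
Proof. by solve_uni; rewrite cst0 addNr. Qed.
Lemma umulA : associative umul.
Proof. by solve_uni; rewrite mulrA. Qed.
Lemma umul1 : left_id (ucst 1) umul.
Proof. by solve_uni; rewrite cst1 mul1r. Qed.
Lemma umulr1 : right_id (ucst 1) umul.
Proof. by solve_uni; rewrite cst1 mulr1. Qed.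
Lemma umulDl : left_distributive umul uadd.
Proof. by solve_uni; rewrite mulrDl. Qed.
Lemma umulDr : right_distributive umul uadd.
Proof. by solve_uni; rewrite mulrDr. Qed.

HB.instance Definition _ := GRing.isPzRing.Build uni
  uaddA uaddC uadd0 uaddN umulA umul1 umulr1 umulDl umulDr.

Lemma ucstD a b : ucst (a + b) = ucst a + ucst b :> uni.
Proof. by apply: clP => A f Cf; rewrite /= !eval_rp //= cstD. Qed.
Lemma ucstM a b : ucst (a * b) = ucst a * ucst b :> uni.
Proof. by apply: clP => A f Cf; rewrite /= !eval_rp //= cstM. Qed.
Lemma ucstC a (u : uni) : ucst a * u = u * ucst a :> uni.
Proof. by apply: clP => A f Cf; rewrite /= !eval_rp //= cstC. Qed.

HB.instance Definition _ := PzRing_isPzAlg.Build F uni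
  ucstD ucstM erefl ucstC.

(* The homomorphism extending a family of values of the generators; it is
   meaningful when [C f] holds. *)
Definition lift (A : pzalgType F) (f : X -> A) (u : uni) : A := eval f (rp u).

Lemma lift_gen (A : pzalgType F) (f : X -> A) x : C f -> lift f (gen x) = f x.
Proof. by move=> Cf; rewrite /lift eval_rp. Qed.

Lemma lift_algmap (A : pzalgType F) (f : X -> A) : C f -> algmap (lift f).
Proof.
by move=> Cf; split=> [u v|u v|a]; rewrite /lift eval_rp.
Qed.

Lemma lift_inj u v :
  (forall (A : pzalgType F) (f : X -> A), C f -> lift f u = lift f v) -> u = v.
Proof. by move=> h; rewrite -[u]rpK -[v]rpK; apply: clP. Qed.

Lemma liftN (A : pzalgType F) (f : X -> A) u : C f -> lift f (- u) = - lift f u.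
Proof. by move=> Cf; rewrite /lift eval_rp. Qed.

Lemma lift1 (A : pzalgType F) (f : X -> A) : C f -> lift f 1 = 1.
Proof. by move=> Cf; rewrite /lift eval_rp //= cst1. Qed.

End Presented.

Section Enveloping.
Variables (F : fieldType) (g : lmodType F) (br : g -> g -> g).

Definition liemap (A : pzalgType F) (f : g -> A) : Prop :=
  linmap f /\ forall u v, f (br u v) = f u * f v - f v * f u.

Definition env := uni liemap.
HB.instance Definition _ := PzAlg.on env.

Definition einj (u : g) : env := gen liemap u.
Definition env_ext (A : pzalgType F) (f : g -> A) : env -> A := lift f.

Lemma einj_liemap : liemap einj.
Proof.
split=> [a u v|u v]; apply: lift_inj => A f Cf;
  have [lD lM lC] := lift_algmap Cf; have [fl fb] := Cf.
- by rewrite lD lM lC !lift_gen.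
- by rewrite lD liftN // !lM !lift_gen.
Qed.

Lemma env_extP (A : pzalgType F) (f : g -> A) : liemap f ->
  algmap (env_ext f) /\ forall u, env_ext f (einj u) = f u.
Proof. by move=> hf; split=> [|u]; [apply: lift_algmap | apply: lift_gen]. Qed.

End Enveloping.

(* A and B tensored over F, generated by the [a (x) 1] and the [1 (x) b]. *)
Section Tensor.
Variables (F : fieldType) (A B : pzalgType F).

Definition commuting_pair (T : pzalgType F) (f : A + B -> T) : Prop :=
  [/\ algmap (f \o inl), algmap (f \o inr)
    & forall a b, f (inl a) * f (inr b) = f (inr b) * f (inl a)].

Definition tensor := uni commuting_pair.
HB.instance Definition _ := PzAlg.on tensor.

Lemma tensor_genP : commuting_pair (gen commuting_pair).
Proof.
split=> [||a b]; last first.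
- apply: lift_inj => T f Cf; have [_ lM _] := lift_algmap Cf.
  by rewrite !lM !lift_gen //; case: Cf.
- by split=> *; apply: lift_inj => T f Cf; have [lD lM lC] := lift_algmap Cf;
    case: (Cf) => _ [fD fM fC] _; rewrite ?lD ?lM ?lC !lift_gen //;
    [apply: fD | apply: fM | apply: fC].
- by split=> *; apply: lift_inj => T f Cf; have [lD lM lC] := lift_algmap Cf;
    case: (Cf) => [[fD fM fC] _ _]; rewrite ?lD ?lM ?lC !lift_gen //;
    [apply: fD | apply: fM | apply: fC].
Qed.

Definition tens (a : A) (b : B) : tensor :=
  gen commuting_pair (inl a) * gen commuting_pair (inr b).

End Tensor.

(* Universal localization; the multiplicative sets used below are Ore sets (they
   consist of commuting ad-semisimple elements), so it is the ring of fractions. *)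
Section Localization.
Variables (F : fieldType) (A : pzalgType F) (S : A -> Prop).

Definition inverting (B : pzalgType F) (f : A + {s : A | S s} -> B) : Prop :=
  algmap (f \o inl) /\
  forall s, f (inl (sval s)) * f (inr s) = 1 /\ f (inr s) * f (inl (sval s)) = 1.

Definition loc := uni inverting.
HB.instance Definition _ := PzAlg.on loc.

Definition linj (a : A) : loc := gen inverting (inl a).

(* The extension of a homomorphism [f] that sends S to invertible elements. *)
Definition loc_ext (B : pzalgType F) (f : A -> B) : loc -> B :=
  lift (fun x => match x with inl a => f a | inr s => rinv (f (sval s)) end).

Lemma loc_genP : inverting (gen inverting).
Proof.
split=> [|s]; first (split=> *; apply: lift_inj => T f Cf;
    have [lD lM lC] := lift_algmap Cf; case: (Cf) => [[fD fM fC] _];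
    rewrite ?lD ?lM ?lC !lift_gen //; [exact: fD | exact: fM | exact: fC]).
by split; apply: lift_inj => T f Cf; have [_ lM lC] := lift_algmap Cf;
   rewrite lM lift1 // !lift_gen //; case: Cf => _ /(_ s) [].
Qed.

Lemma loc_extP (B : pzalgType F) (f : A -> B) :
  algmap f -> (forall s, S s -> exists b, f s * b = 1 /\ b * f s = 1) ->
  algmap (loc_ext f) /\ forall a, loc_ext f (linj a) = f a.
Proof.
move=> fA fS; pose f' (x : A + {s : A | S s}) : B :=
  match x with inl a => f a | inr s => rinv (f (sval s)) end.
have Cf : inverting f'.
  split=> //= -[s Ss] /=; have [b [fb bf]] := fS s Ss.
  by rewrite (rinv_eq fb bf).
by split=> [|a]; [apply: (lift_algmap Cf) | apply: (lift_gen (inl a) Cf)].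
Qed.

End Localization.

Inductive hset (A : pzRingType) (n : nat) (h : 'I_n -> A) : A -> Prop :=
| hset1 : hset h 1
| hsetM a i j (k : int) : i != j -> hset h a -> hset h (a * (h i - h j + k%:~R)).

Section Weyl.
Variables (F : fieldType) (m : nat).
Local Notation P := {mpoly F[m]}.

Inductive isdiff : (P -> P) -> Prop :=
| isdiff_id : isdiff id
| isdiff_X i : isdiff (fun p => 'X_i * p)
| isdiff_d i : isdiff (fun p => mderiv i p)
| isdiff_lin (a : F) f g : isdiff f -> isdiff g -> isdiff (fun p => a *: f p + g p)
| isdiff_comp f g : isdiff f -> isdiff g -> isdiff (fun p => f (g p)).

Record diffop : Type := DiffOp { dfun :> P -> P; dfunP : isdiff dfun }.

Lemma diffop_eq (f g : diffop) : (forall p, f p = g p) -> f = g.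
Proof.
case: f g => f fP [g gP] /= /funext e; case: _ / e gP => gP.
by congr DiffOp; apply: Prop_irrelevance.
Qed.

HB.instance Definition _ := gen_eqMixin diffop.
HB.instance Definition _ := gen_choiceMixin diffop.

Lemma diffop_linear (f : diffop) (a : F) p q : f (a *: p + q) = a *: f p + f q.
Proof.
case: f => f /= fP; elim: fP p q => [|i|i|b g h _ IHg _ IHh|g h _ IHg _ IHh] p q //=.
- by rewrite mulrDr scalerAr.
- by rewrite mderivD mderivZ.
- by rewrite IHg IHh !scalerDr !scalerA mulrC addrACA.
- by rewrite IHh IHg.
Qed.

Lemma diffop0 (f : diffop) : f 0 = 0.
Proof.
by have := diffop_linear f (-1) 0 0; rewrite scaler0 addr0 scaleN1r addNr.
Qed.

Lemma isdiff0 : isdiff (fun=> 0).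
Proof.
have := isdiff_lin (-1) isdiff_id isdiff_id.
by congr isdiff; apply/funext => p; rewrite scaleN1r addNr.
Qed.

Definition dzero : diffop := DiffOp isdiff0.
Definition dunit : diffop := DiffOp isdiff_id.
Definition dlin a (f g : diffop) := DiffOp (isdiff_lin a (dfunP f) (dfunP g)).
Definition dcomp (f g : diffop) := DiffOp (isdiff_comp (dfunP f) (dfunP g)).
Definition dadd f g := dlin 1 f g.
Definition dopp f := dlin (-1) f dzero.
Definition dcst a := dlin a dunit dzero.

Ltac solve_diff := repeat move=> ?; apply: diffop_eq => p /=;
  rewrite ?diffop_linear ?scale1r ?addr0.

Lemma daddA : associative dadd.
Proof. by solve_diff; rewrite addrA. Qed.
Lemma daddC : commutative dadd.
Proof. by solve_diff; rewrite addrC. Qed.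
Lemma dadd0 : left_id dzero dadd.
Proof. by solve_diff; rewrite add0r. Qed.
Lemma daddN : left_inverse dzero dopp dadd.
Proof. by solve_diff; rewrite scaleN1r addNr. Qed.
Lemma dmulA : associative dcomp.
Proof. by solve_diff. Qed.
Lemma dmul1 : left_id dunit dcomp.
Proof. by solve_diff. Qed.
Lemma dmulr1 : right_id dunit dcomp.
Proof. by solve_diff. Qed.
Lemma dmulDl : left_distributive dcomp dadd.
Proof. by solve_diff. Qed.
Lemma dmulDr : right_distributive dcomp dadd.
Proof. by solve_diff. Qed.

HB.instance Definition _ := GRing.isPzRing.Build diffop
  daddA daddC dadd0 daddN dmulA dmul1 dmulr1 dmulDl dmulDr.

Lemma dcstD a b : dcst (a + b) = dcst a + dcst b :> diffop.
Proof. by solve_diff; rewrite scalerDl. Qed.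
Lemma dcstM a b : dcst (a * b) = dcst a * dcst b :> diffop.
Proof. by solve_diff; rewrite scalerA. Qed.
Lemma dcst1 : dcst 1 = 1 :> diffop.
Proof. by solve_diff. Qed.
Lemma dcstC a (u : diffop) : dcst a * u = u * dcst a :> diffop.
Proof. by solve_diff; rewrite diffop0 addr0. Qed.

HB.instance Definition _ := PzRing_isPzAlg.Build F diffop
  dcstD dcstM dcst1 dcstC.

Definition dX (i : 'I_m) : diffop := DiffOp (isdiff_X i).
Definition dD (i : 'I_m) : diffop := DiffOp (isdiff_d i).

End Weyl.

(* The basis element e_ij of gl_n is [delta_mx i j]. *)
Section Enveloping_gl.
Variables (F : fieldType) (n : nat).

Definition glbr (X Y : 'M[F]_n) : 'M[F]_n := X *m Y - Y *m X.
Definition Ugl := env glbr.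
HB.instance Definition _ := PzAlg.on Ugl.

(* The Cartan subalgebra is the row space, embedded in gl_n by [diag_mx]. *)
Definition Uh := env (fun _ _ : 'rV[F]_n => 0).
HB.instance Definition _ := PzAlg.on Uh.
Definition uh (i : 'I_n) : Uh := einj _ (delta_mx 0 i).

Definition Uhbar := loc (hset uh).
HB.instance Definition _ := PzAlg.on Uhbar.
Definition hb (i : 'I_n) : Uhbar := linj _ (uh i).

(* h~_i = h_i - i, with the indices counted from 1. *)
Definition ht (i : 'I_n) : Uhbar := hb i - (i.+1)%:R.
Definition htd (i j : 'I_n) : Uhbar := ht i - ht j.

(* f[alpha], for alpha a linear form on the Cartan subalgebra. *)
Definition shift (alpha : 'rV[F]_n -> F) : Uhbar -> Uhbar :=
  loc_ext (env_ext (fun d => linj _ (einj _ d) + cst (alpha d))).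
Definition eps (k : 'I_n) (d : 'rV[F]_n) : F := d 0 k.

Definition varphi (j : 'I_n) : Uhbar :=
  \prod_(k < n | (j < k)%N) (htd j k * rinv (htd j k - 1)).

(* [Rhat i j k l] has upper indices i j and lower indices k l. *)
Definition Rhat (i j k l : 'I_n) : Uhbar :=
  if [&& k == i, l == j & i != j] then rinv (htd i j)
  else if (k == j) && (l == i) then
    if (i < j)%N then (htd i j ^+ 2 - 1) * rinv (htd i j ^+ 2) else 1
  else 0.

End Enveloping_gl.

(* [iota] is the inclusion of gl_n in the algebra A, and [bar] is the algebra
   structure on A tensored over U(h) with the localization of U(h). *)
Section DoubleCosets.
Variables (F : fieldType) (n : nat) (A : pzalgType F) (iota : 'M[F]_n -> A).

Definition bar := loc (hset (fun i => iota (delta_mx i i))).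
HB.instance Definition _ := PzAlg.on bar.

Definition binj (a : A) : bar := linj _ a.
Definition Eb (i j : 'I_n) : bar := binj (iota (delta_mx i j)).

Definition of_Uhbar : Uhbar F n -> bar :=
  loc_ext (env_ext (fun d => binj (iota (diag_mx d)))).

Definition in_nminus_bar (u : bar) : Prop := exists a : 'I_n -> 'I_n -> bar,
  u = \sum_(i < n) \sum_(j < n | (j < i)%N) Eb i j * a i j.
Definition in_bar_nplus (u : bar) : Prop := exists a : 'I_n -> 'I_n -> bar,
  u = \sum_(i < n) \sum_(j < n | (i < j)%N) a i j * Eb i j.

(* bar * n_+ ^ k *)
Fixpoint in_bar_nplus_pow (k : nat) (u : bar) : Prop :=
  if k is k'.+1 then
    exists2 a : 'I_n -> 'I_n -> bar, forall i j, in_bar_nplus_pow k' (a i j)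
      & u = \sum_(i < n) \sum_(j < n | (i < j)%N) a i j * Eb i j
  else True.

Definition cosets : {pred bar} := fun u =>
  `[< exists v w, [/\ in_nminus_bar v, in_bar_nplus w & u = v + w] >].

Lemma cosets_closed : zmod_closed cosets.
Proof.
split=> [|u v /asboolP[_ [_ [[a ->] [b ->] ->]]] /asboolP[_ [_ [[c ->] [d ->] ->]]]].
  apply/asboolP; exists 0, 0; split; last by rewrite addr0.
  - by exists (fun _ _ => 0); rewrite big1 // => i _; rewrite big1 // => j _; rewrite mulr0.
  - by exists (fun _ _ => 0); rewrite big1 // => i _; rewrite big1 // => j _; rewrite mul0r.
apply/asboolP; eexists; eexists; split; last first.
- by rewrite opprD addrACA; congr (_ + _); reflexivity.
- exists (fun i j => b i j - d i j); rewrite -sumrB; apply: eq_bigr => i _.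
  by rewrite -sumrB; apply: eq_bigr => j _; rewrite mulrBl.
- exists (fun i j => a i j - c i j); rewrite -sumrB; apply: eq_bigr => i _.
  by rewrite -sumrB; apply: eq_bigr => j _; rewrite mulrBr.
Qed.

HB.instance Definition _ := GRing.isZmodClosed.Build bar cosets cosets_closed.

Definition red : zmodType := Quotient.quot cosets.
Definition cls (u : bar) : red := \pi_(Quotient.quot cosets) u.
Definition rpr (x : red) : bar := repr (x : Quotient.quot cosets).

(* [cosets] is a sub-bimodule over the localized U(h), so that these do not
   depend on the representative; the same holds for [diamond]. *)
Definition lact (f : Uhbar F n) (x : red) : red := cls (of_Uhbar f * rpr x).
Definition ract (x : red) (f : Uhbar F n) : red := cls (rpr x * of_Uhbar f).

End DoubleCosets.

Section Projector.
Variables (F : fieldType) (n : nat).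

Definition Ugbar := bar (einj (@glbr F n)).
HB.instance Definition _ := PzAlg.on Ugbar.
Definition gx (X : 'M[F]_n) : Ugbar := binj _ (einj _ X).

Definition nplus (X : 'M[F]_n) : Prop :=
  forall i j : 'I_n, (j <= i)%N -> X i j = 0.
Definition nminus (X : 'M[F]_n) : Prop :=
  forall i j : 'I_n, (i <= j)%N -> X i j = 0.

(* Products of root vectors e_ij, of given total height; a pair stands for e_ij
   and e_ij has height |i - j|. *)
Definition raising (b : nat) (s : seq ('I_n * 'I_n)) : bool :=
  all (fun p : 'I_n * 'I_n => p.1 < p.2)%N s && (sumn [seq (p.2 - p.1)%N | p : 'I_n * 'I_n <- s] == b).
Definition lowering (a : nat) (s : seq ('I_n * 'I_n)) : bool :=
  all (fun p : 'I_n * 'I_n => p.2 < p.1)%N s && (sumn [seq (p.1 - p.2)%N | p : 'I_n * 'I_n <- s] == a).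
Definition mono (s : seq ('I_n * 'I_n)) : Ugbar :=
  \prod_(p <- s) Eb _ p.1 p.2.

(* The component U(n_-)_{-a} Ubar(h) U(n_+)_b of Ubar(g). *)
Definition normal (a b : nat) (u : Ugbar) : Prop :=
  exists2 r : seq (seq ('I_n * 'I_n) * Uhbar F n * seq ('I_n * 'I_n)),
    all (fun q => lowering a q.1.1 && raising b q.2) r
    & u = \sum_(q <- r) mono q.1.1 * of_Uhbar _ q.1.2 * mono q.2.

(* Elements of the completion: formal sums of normally ordered terms of
   bounded weight.  By PBW the components are determined by the series, and
   there are finitely many monomials in each of them. *)
Record fseries : Type := FSeries {
  coef :> nat -> nat -> Ugbar;
  coef_normal : forall a b, normal a b (coef a b);
  coef_bounded : exists c, forall a b : nat,
    (a + c < b)%N || (b + c < a)%N -> coef a b = 0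
}.

Definition psum (P : fseries) (M : nat) : Ugbar :=
  \sum_(a < M) \sum_(b < M) P a b.

(* The limit in the completion of a sequence of elements of bounded weight is
   0: the terms of right height less than any k disappear eventually. *)
Definition vanishing (u : nat -> Ugbar) : Prop :=
  forall k, exists M0, forall M, (M0 <= M)%N -> in_bar_nplus_pow k (u M).

Definition extremal_projector (P : fseries) : Prop :=
  [/\ forall X, nplus X -> vanishing (fun M => gx X * psum P M),
      forall Y, nminus Y -> vanishing (fun M => psum P M * gx Y),
      forall M, in_nminus_bar (psum P M.+1 - 1),
      forall M, in_bar_nplus (psum P M.+1 - 1)
    & vanishing (fun M => psum P M * psum P M - psum P M)].

End Projector.

Section Diamond.
Variables (F : fieldType) (n : nat) (A : pzalgType F) (iota : 'M[F]_n -> A).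
Variable P : fseries F n.

Definition of_Ugbar : Ugbar F n -> bar iota :=
  loc_ext (fun u => binj iota (env_ext iota u)).

(* The class of x P y: the partial sums of P give classes that are eventually
   constant, as gl_n acts locally finitely. *)
Definition diamond (x y : red iota) : red iota :=
  xget 0 [set z : red iota | exists M0, forall M, (M0 <= M)%N ->
    cls (rpr x * of_Ugbar (psum P M) * rpr y) = z].

End Diamond.

Section Diff.
Variables (F : fieldType) (n N : nat).

Definition Diff := diffop F (n * N).
HB.instance Definition _ := PzAlg.on Diff.

Definition xvar (i : 'I_n) (alpha : 'I_N) : Diff := dX F (mxvec_index i alpha).
Definition dvar (j : 'I_n) (beta : 'I_N) : Diff := dD F (mxvec_index j beta).

Definition psi (X : 'M[F]_n) : Diff := \sum_(i < n) \sum_(j < n)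
  cst (X i j) * \sum_(alpha < N) xvar i alpha * dvar j alpha.

Definition diagonal (X : 'M[F]_n) : tensor Diff (Ugl F n) :=
  tens (psi X) 1 + tens 1 (einj _ X).

Definition Diffh := red diagonal.

Definition dhx (i : 'I_n) (alpha : 'I_N) : Diffh :=
  cls (binj diagonal (tens (xvar i alpha) 1)).
Definition dhd (j : 'I_n) (beta : 'I_N) : Diffh :=
  cls (binj diagonal (tens (dvar j beta) 1)).
Definition dhdbar (j : 'I_n) (beta : 'I_N) : Diffh :=
  ract (dhd j beta) (varphi F j).
Definition dh1 : Diffh := cls (1 : bar diagonal).

End Diff.

(* Main.v *)
(* Modulo the left ideal generated by n_+, the vector P x^j is the unique highest
   weight vector congruent to x^j modulo n_-, so diamond products can be computed
   without knowing P.  This vector is produced by the matrix of generators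
   E = (e_ij): for a family u transforming like (x^1, ..., x^n) under n_+, the
   family (E u)_j = sum_i e_ji u_i transforms in the same way, and E is triangular
   modulo n_+ with eigenvalues kappa_j = h_j + n - j + 1 acting on the right.
   Hence u |-> E u - u kappa_m, applied for m = 1, ..., j - 1, annihilates the
   coordinates before the j-th one and makes the j-th one a highest weight
   vector.  Pairing this recursion with x^i or d_i on the left expresses every
   diamond product through the classes of ordinary products, with coefficients
   that are eigenvectors of triangular matrices.  The reordering relations are
   then identities between rational functions of the h~_i, the diagonal case of
   the third one being a partial fraction expansion.  The variables d_j are
   treated like the x^j, through the automorphism e_ij |-> - e_{n+1-j,n+1-i}. *)

Require Import Defs.
From HB Require Import structures.
From mathcomp Require Import all_boot all_order all_algebra.
From mathcomp Require Import boolp reals complex mpoly ring.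
From mathcomp Require classical_sets.

Set Implicit Arguments.
Unset Strict Implicit.
Unset Printing Implicit Defensive.

Import GRing.Theory.
Local Open Scope ring_scope.

(** The hypotheses on P control its partial sums only modulo high powers of n_+, while a class is
    taken modulo bar n_+ itself. Local nilpotency closes the gap: for every m there is a k such that
    right multiplication by a given element sends bar n_+^k into bar n_+^m. Hence late partial sums
    kill n_- bar modulo bar n_+, and the limit that defines the product is eventually constant;
    besides this, only the congruence of P to 1 modulo bar n_+ is used. The factor varphi_i has its
    origin in the product of x^i with d_i. The eigenvector needed there has the denominator
    varphi_i; multiplying d_i by varphi_i clears it and turns the entries into differences of
    consecutive partial products of the factors h/(h - 1). Their sum telescopes to 1, which is the
    delta term of the third relation. The same factors produce the numerators (h^2 - 1)/h^2 of the
    matrix when the two orders of a product are compared. Denominators are always handled through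
    explicit two-sided inverses, so an identity of rational functions is proved by multiplying it by
    an invertible element or by inserting the equation of an inverse. *)

(** * Homomorphisms of algebras and linear maps into algebras *)

Section AlgebraMaps.
Variables (F : fieldType) (A B : pzalgType F) (f : A -> B).
Hypothesis fP : algmap f.

Lemma algmapD u v : f (u + v) = f u + f v. Proof. by case: fP. Qed.
Lemma algmapM u v : f (u * v) = f u * f v. Proof. by case: fP. Qed.
Lemma algmap_cst a : f (cst a) = cst a. Proof. by case: fP. Qed.
Lemma algmap0 : f 0 = 0. Proof. by rewrite -!(cst0 (F := F)) algmap_cst. Qed.
Lemma algmap1 : f 1 = 1. Proof. by rewrite -!(cst1 (s := _)) algmap_cst. Qed.
Lemma algmapN u : f (- u) = - f u.
Proof. by apply: (addrI (f u)); rewrite -algmapD !subrr algmap0. Qed.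
Lemma algmapB u v : f (u - v) = f u - f v.
Proof. by rewrite algmapD algmapN. Qed.
Lemma algmap_sum (I : Type) (r : seq I) (Q : pred I) (g : I -> A) :
  f (\sum_(i <- r | Q i) g i) = \sum_(i <- r | Q i) f (g i).
Proof. exact: (big_morph f algmapD algmap0). Qed.
Lemma algmap_prod (I : Type) (r : seq I) (Q : pred I) (g : I -> A) :
  f (\prod_(i <- r | Q i) g i) = \prod_(i <- r | Q i) f (g i).
Proof. exact: (big_morph f algmapM algmap1). Qed.
Lemma algmap_nat k : f k%:R = k%:R.
Proof. by elim: k => [|k IH]; rewrite ?algmap0 // -!natr1 algmapD IH algmap1. Qed.
Lemma algmap_int (k : int) : f k%:~R = k%:~R.
Proof. by case: k => k; rewrite ?NegzE ?mulrNz ?algmapN -!pmulrn algmap_nat. Qed.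

End AlgebraMaps.

Section CstInt.
Variables (F : fieldType) (A : pzalgType F).

Lemma cstN (a : F) : cst (- a) = - cst a :> A.
Proof. by apply: (addrI (cst a)); rewrite -cstD !subrr cst0. Qed.
Lemma cst_nat k : cst (k%:R : F) = k%:R :> A.
Proof. by elim: k => [|k IH]; rewrite ?cst0 // -!natr1 cstD IH cst1. Qed.
Lemma cst_int (k : int) : cst (k%:~R : F) = k%:~R :> A.
Proof. by case: k => k; rewrite ?NegzE ?mulrNz ?cstN -!pmulrn cst_nat. Qed.

End CstInt.

Lemma algmap_comp (F : fieldType) (A B D : pzalgType F) (f : A -> B) (g : B -> D) :
  algmap f -> algmap g -> algmap (g \o f).
Proof.
by move=> fP gP; split=> *; rewrite /= ?(algmapD fP) ?(algmapM fP) ?(algmap_cst fP)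
  ?(algmapD gP) ?(algmapM gP) ?(algmap_cst gP).
Qed.

Section LinearMaps.
Variables (F : fieldType) (V : lmodType F) (A : pzalgType F) (f : V -> A).
Hypothesis fP : linmap f.

Lemma linmap0 : f 0 = 0.
Proof.
have := fP (-1) 0 0; rewrite scaler0 addr0 => e.
by rewrite e cstN cst1 mulN1r addNr.
Qed.
Lemma linmapZ a u : f (a *: u) = cst a * f u.
Proof. by rewrite -[a *: u]addr0 fP linmap0 addr0. Qed.
Lemma linmapD u v : f (u + v) = f u + f v.
Proof. by rewrite -[u]scale1r fP cst1 mul1r scale1r. Qed.
Lemma linmapN u : f (- u) = - f u.
Proof. by rewrite -scaleN1r linmapZ cstN cst1 mulN1r. Qed.
Lemma linmap_sum (I : Type) (r : seq I) (Q : pred I) (g : I -> V) :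
  f (\sum_(i <- r | Q i) g i) = \sum_(i <- r | Q i) f (g i).
Proof. exact: (big_morph f linmapD linmap0). Qed.

End LinearMaps.

(** * Induction principles for presented algebras and localizations *)

Section PresentedInduction.
Variables (F : fieldType) (X : Type).
Variable C : forall A : pzalgType F, (X -> A) -> Prop.

Lemma uni_ind (Q : uni C -> Prop) :
  (forall x, Q (gen C x)) -> (forall a, Q (cst a)) ->
  (forall u, Q u -> Q (- u)) ->
  (forall u v, Q u -> Q v -> Q (u + v)) ->
  (forall u v, Q u -> Q v -> Q (u * v)) -> forall u, Q u.
Proof.
move=> Qg Qc QN QD QM u; rewrite -[u]rpK.
elim: (rp u) => [x|a|t IH|s IHs t IHt|s IHs t IHt]; [exact: Qg|exact: Qc|..].
- suff -> : cl C (Opp t) = - cl C t by apply: QN.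
  by apply: clP => A f Cf /=; rewrite eval_rp.
- suff -> : cl C (Add s t) = cl C s + cl C t by apply: QD.
  by apply: clP => A f Cf /=; rewrite !eval_rp.
- suff -> : cl C (Mul s t) = cl C s * cl C t by apply: QM.
  by apply: clP => A f Cf /=; rewrite !eval_rp.
Qed.

End PresentedInduction.

Section LocalizationFacts.
Variables (F : fieldType) (A : pzalgType F) (S : A -> Prop).

Lemma linj_algmap : algmap (@linj F A S).
Proof. by case: (loc_genP S). Qed.

Lemma linj_inv s : S s ->
  exists b : loc S, linj S s * b = 1 /\ b * linj S s = 1.
Proof.
move=> Ss; exists (gen (inverting (S := S)) (inr (exist _ s Ss))).
by case: (loc_genP S) => _ /(_ (exist _ s Ss)).
Qed.

Lemma loc_ind (Q : loc S -> Prop) :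
  (forall a, Q (linj S a)) ->
  (forall s b, S s -> linj S s * b = 1 -> b * linj S s = 1 -> Q b) ->
  (forall u v, Q u -> Q v -> Q (u + v)) ->
  (forall u v, Q u -> Q v -> Q (u * v)) -> forall u, Q u.
Proof.
move=> Ql Qi QD QM; apply: uni_ind => [[a|[s Ss]]|a|u Qu|//|//].
- exact: Ql.
- by case: (loc_genP S) => _ /(_ (exist _ s Ss)) [] /= h1 h2; apply: (Qi s).
- by rewrite -(algmap_cst linj_algmap); apply: Ql.
- rewrite -mulN1r -(algmap1 linj_algmap) -(algmapN linj_algmap).
  by apply: QM.
Qed.

End LocalizationFacts.

Section Commutation.
Variable A : pzRingType.

Lemma comm_inv (u s b : A) : s * b = 1 -> b * s = 1 -> GRing.comm u s ->
  GRing.comm u b.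
Proof.
move=> sb bs us; rewrite /GRing.comm -[u * b]mul1r -bs -mulrA [s * (u * b)]mulrA.
by rewrite -us -mulrA sb mulr1.
Qed.

End Commutation.

(** * The localized Cartan algebra and its shift automorphisms *)

Section CartanAlgebra.
Variables (F : fieldType) (n : nat).
Local Notation U := (Uhbar F n).
Local Notation uhset := (hset (@uh F n)).

Lemma Uh_mulC (a b : Uh F n) : a * b = b * a.
Proof.
have [einjl einjb] := einj_liemap (fun _ _ : 'rV[F]_n => 0).
suff H (v : 'rV[F]_n) (u : Uh F n) : GRing.comm (einj _ v) u.
  move: b; apply: uni_ind => [x|c|u h|u v hu hv|u v hu hv].
  - exact/commr_sym/H.
  - exact/commr_sym/cstC.
  - exact: commrN.
  - exact: commrD.
  - exact: commrM.
move: u; apply: uni_ind => [x|c|u h|u w hu hw|u w hu hw].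
- apply/eqP; rewrite -subr_eq0 -[gen _ x]/(einj _ x).
  by apply/eqP; rewrite -einjb (linmap0 einjl).
- exact/commr_sym/cstC.
- exact: commrN.
- exact: commrD.
- exact: commrM.
Qed.

(** Commutation passes from generators to inverses. The resulting commutative ring structure lets
    [ring] prove the coefficient identities below. *)
Lemma Uhbar_mulC : commutative (@GRing.mul U).
Proof.
have linjP := linj_algmap uhset.
suff H (a : Uh F n) (u : U) : GRing.comm (linj _ a) u.
  move=> a; apply: loc_ind => [x|s b _ sb bs|u v hu hv|u v hu hv].
  - exact/commr_sym/H.
  - by apply: comm_inv sb bs _; apply/commr_sym/H.
  - exact: commrD.
  - exact: commrM.
move: u; apply: loc_ind => [x|s b _ sb bs|u v hu hv|u v hu hv].
- by rewrite /GRing.comm -!(algmapM linjP) Uh_mulC.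
- by apply: comm_inv sb bs _; rewrite /GRing.comm -!(algmapM linjP) Uh_mulC.
- exact: commrD.
- exact: commrM.
Qed.

HB.instance Definition _ := GRing.PzRing_hasCommutativeMul.Build U Uhbar_mulC.

(** The last clause absorbs the whole multiplicative set: a property that passes from an element to
    its inverse needs to be checked only on the [hb F i] and the scalars, besides sums and
    products. *)
Lemma Uhbar_ind (Q : U -> Prop) :
  (forall i, Q (hb F i)) -> (forall a, Q (cst a)) ->
  (forall u v, Q u -> Q v -> Q (u + v)) ->
  (forall u v, Q u -> Q v -> Q (u * v)) ->
  (forall u v, u * v = 1 -> Q u -> Q v) -> forall u, Q u.
Proof.
move=> Qh Qc QD QM Qi.
have linjP := linj_algmap uhset.
have [einjl einjb] := einj_liemap (fun _ _ : 'rV[F]_n => 0).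
have Q0 : Q 0 by rewrite -(cst0 (F := F)).
have Ql (a : Uh F n) : Q (linj _ a).
  move: a; apply: uni_ind => [d|c|u h|u w hu hw|u w hu hw].
  - rewrite -[gen _ d]/(einj _ d) (row_sum_delta d) (linmap_sum einjl) (algmap_sum linjP).
    apply: (big_ind Q) => // i _.
    rewrite (linmapZ einjl) (algmapM linjP) (algmap_cst linjP).
    by apply: QM => //; apply: Qh.
  - by rewrite (algmap_cst linjP).
  - by rewrite (algmapN linjP) -mulN1r -(cst1 (F := F) (s := U)) -cstN; apply: QM.
  - by rewrite (algmapD linjP); apply: QD.
  - by rewrite (algmapM linjP); apply: QM.
by apply: loc_ind => // s b _ sb bs; apply: Qi sb _.
Qed.

End CartanAlgebra.

Lemma hset_gen (A : pzRingType) n (h : 'I_n -> A) i j (k : int) :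
  i != j -> hset h (h i - h j + k%:~R).
Proof. by move=> ij; rewrite -[X in hset _ X]mul1r; apply: hsetM ij (hset1 h). Qed.

Lemma hset_morph (F : fieldType) (A B : pzalgType F) (f : A -> B) n
    (h : 'I_n -> A) (s : A) : algmap f ->
  hset h s -> hset (f \o h) (f s).
Proof.
move=> fP; elim=> [|a i j k ij _ IH]; first by rewrite (algmap1 fP); constructor.
rewrite (algmapM fP) (algmapD fP) (algmapB fP) (algmap_int fP).
exact: (hsetM (h := f \o h)).
Qed.

(* Units in the sense of a two-sided inverse: the rings at hand are not
   instances of [unitRingType]. *)
Definition invertible (A : pzRingType) (a : A) : Prop :=
  exists b, a * b = 1 /\ b * a = 1.

Lemma rinvP (A : pzRingType) (a : A) : invertible a ->
  a * rinv a = 1 /\ rinv a * a = 1.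
Proof. by move=> [b [ab ba]]; rewrite (rinv_eq ab ba). Qed.

Lemma invertibleM (A : pzRingType) (a b : A) :
  invertible a -> invertible b -> invertible (a * b).
Proof.
move=> [c [ac ca]] [d [bar_d db]]; exists (d * c); split.
  by rewrite -mulrA [b * _]mulrA bar_d mul1r.
by rewrite -mulrA [c * _]mulrA ca mul1r.
Qed.

Lemma hset_invertible (A : pzRingType) n (h : 'I_n -> A) :
  (forall i j (k : int), i != j -> invertible (h i - h j + k%:~R)) ->
  forall s, hset h s -> invertible s.
Proof.
move=> H s; elim=> [|a i j k ij _ IH]; first by exists 1; rewrite mulr1.
exact/invertibleM/H.
Qed.

Section CartanShift.
Variables (F : fieldType) (n : nat).
Local Notation U := (Uhbar F n).

Definition hlin : Uh F n -> U := linj _.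

Lemma hlin_algmap : algmap hlin. Proof. exact: linj_algmap. Qed.

Lemma hb_invertible (i j : 'I_n) (k : int) : i != j -> invertible (hb F i - hb F j + k%:~R).
Proof.
have lP := hlin_algmap.
move=> ij; rewrite -[hb F i]/(hlin (uh F i)) -[hb F j]/(hlin (uh F j)).
rewrite -(algmapB lP) -(algmap_int lP) -(algmapD lP).
exact/linj_inv/hset_gen.
Qed.

(** Restricted to integral weights: the shift then permutes the elements h_i - h_j + k for fixed i
    and j, so it extends to the localization. *)
Definition hshift (w : 'I_n -> int) : U -> U :=
  shift (fun d : 'rV[F]_n => \sum_i d 0 i * (w i)%:~R).

Let shgen (w : 'I_n -> int) (d : 'rV[F]_n) : U :=
  hlin (einj _ d) + cst (\sum_i d 0 i * (w i)%:~R).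

Let shgenP w : liemap (fun _ _ : 'rV[F]_n => 0) (shgen w).
Proof.
have lP := hlin_algmap.
have [el _] := einj_liemap (fun _ _ : 'rV[F]_n => 0).
split=> [a u v|u v]; last first.
  rewrite [X in _ - X]mulrC subrr /shgen (linmap0 el) (algmap0 lP) add0r.
  rewrite (_ : \sum_i _ = 0) ?cst0 //.
  by apply: big1 => i _; rewrite mxE mul0r.
rewrite /shgen.
rewrite el.
rewrite (algmapD lP).
rewrite (algmapM lP).
rewrite (algmap_cst lP).
rewrite mulrDr.
rewrite -cstM.
rewrite addrACA -cstD mulr_sumr -big_split /=.
rewrite (_ : \sum_i (a *: u + v) 0 i * _
  = \sum_i (a * (u 0 i * (w i)%:~R) + v 0 i * (w i)%:~R)) //.
by apply: eq_bigr => i _; rewrite !mxE mulrDl mulrA.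
Qed.

Let shgen_uh w i : env_ext (shgen w) (uh F i) = hb F i + (w i)%:~R.
Proof.
have [_ ->] := env_extP (shgenP w); congr (_ + _); rewrite (bigD1 i) //=.
rewrite mxE !eqxx mul1r big1 ?addr0 ?cst_int // => j ji.
by rewrite mxE eqxx /= (negbTE ji) mul0r.
Qed.

(* Here and below, exact_no_check postpones to Qed a conversion between an
   algebra and its unfolding as a localization, on which unification diverges. *)
Let shP w : algmap (hshift w) /\ forall a, hshift w (hlin a) = env_ext (shgen w) a.
Proof.
have [eP _] := env_extP (shgenP w).
have H s : hset (@uh F n) s -> invertible (env_ext (shgen w) s).
  move/(hset_morph eP); apply: hset_invertible => i j k ij /=.
  rewrite !shgen_uh.
  have -> : hb F i + (w i)%:~R - (hb F j + (w j)%:~R) + k%:~R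
      = hb F i - hb F j + (w i - w j + k)%:~R.
    by rewrite !intrD mulrNz; ring.
  exact: hb_invertible.
have [L1 L2] := loc_extP eP H.
by split; [exact_no_check L1 | exact_no_check L2].
Qed.

Lemma hshift_algmap w : algmap (hshift w). Proof. by case: (shP w). Qed.
Lemma hshift_hb w i : hshift w (hb F i) = hb F i + (w i)%:~R.
Proof. by case: (shP w) => _ ->; rewrite shgen_uh. Qed.

Lemma hshiftK w : cancel (hshift (fun i => - w i)) (hshift w).
Proof.
have P1 := hshift_algmap w; have P2 := hshift_algmap (fun i => - w i).
apply: Uhbar_ind => [i|a|u v hu hv|u v hu hv|u v uv hu].
- by rewrite hshift_hb (algmapD P1) hshift_hb (algmap_int P1) mulrNz addrK.
- by rewrite (algmap_cst P2) (algmap_cst P1).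
- by rewrite (algmapD P2) (algmapD P1) hu hv.
- by rewrite (algmapM P2) (algmapM P1) hu hv.
- have e : hshift w (hshift (fun i => - w i) v) * u = 1.
    by rewrite -[X in _ * X]hu -(algmapM P1) -(algmapM P2) mulrC uv (algmap1 P2) (algmap1 P1).
  by rewrite -[LHS]mulr1 -uv mulrA e mul1r.
Qed.

Lemma shift_eps k : shift (@eps F n k) =1 hshift (fun i => (i == k)%:R).
Proof.
move=> f; congr (shift _ f); apply/funext => d; rewrite /eps (bigD1 k) //= eqxx.
by rewrite mulr1 big1 ?addr0 // => j /negbTE ->; rewrite mulr0.
Qed.

Lemma hshift_inv w f g : f * g = 1 -> hshift w f * hshift w g = 1.
Proof. by have P := hshift_algmap w; rewrite -(algmapM P) => ->; rewrite (algmap1 P). Qed.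

End CartanShift.

Arguments hshift {F n} w f.
Arguments hlin {F n} a.
Arguments hshift_algmap {F n} w.
Arguments hlin_algmap {F n}.

(** * Adjoint weights in the localized algebra *)

Section BarAlgebra.
Variables (F : fieldType) (n : nat) (A : pzalgType F) (iota : 'M[F]_n -> A).
Hypothesis iotaP : liemap (@glbr F n) iota.
Local Notation U := (Uhbar F n).
Local Notation B := (bar iota).
Local Notation O := (of_Uhbar iota).
Local Notation E := (Eb iota).

Lemma binj_algmap : algmap (binj iota). Proof. exact: linj_algmap. Qed.

Lemma Eb_comm i j k l :
  E i j * E k l - E k l * E i j = E i l *+ (j == k) - E k j *+ (l == i).
Proof.
have [il ib] := iotaP; have bP := binj_algmap.
rewrite -!(algmapM bP) -(algmapB bP) -ib /glbr !mul_delta_mx_cond.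
rewrite (linmapD il) (linmapN il) (algmapB bP).
by case: (j == k); case: (l == i); rewrite ?(linmap0 il) ?(algmap0 bP).
Qed.

Lemma Eb_diff_invertible i j (k : int) : i != j ->
  invertible (E i i - E j j + k%:~R).
Proof.
have bP := binj_algmap.
move=> ij; rewrite /Eb -(algmapB bP) -(algmap_int bP) -(algmapD bP).
apply: linj_inv; exact: (@hset_gen _ _ (fun i => iota (delta_mx i i))).
Qed.

Let dg (d : 'rV[F]_n) : B := binj iota (iota (diag_mx d)).

Let dgP : liemap (fun _ _ : 'rV[F]_n => 0) dg.
Proof.
have [il ib] := iotaP; have bP := binj_algmap; split=> [a u v|u v].
  by rewrite /dg linearP il (algmapD bP) (algmapM bP) (algmap_cst bP).
rewrite /dg -!(algmapM bP) -(algmapB bP) -ib /glbr diag_mxC subrr.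
by rewrite (linmap0 il) raddf0 (linmap0 il).
Qed.

Let dg_uh i : env_ext dg (uh F i) = E i i.
Proof.
have [_ ->] := env_extP dgP; rewrite /dg /Eb; congr (binj _ (iota _)).
apply/matrixP => a b; rewrite !mxE eqxx /=.
case: (eqVneq a b) => [->|ab]; first by rewrite andbb mulr1n.
by rewrite mulr0n; case: (eqVneq b i) => [<-|_]; rewrite ?(negbTE ab) ?andbF.
Qed.

Let OP : algmap O /\ forall a, O (hlin a) = env_ext dg a.
Proof.
have [eP _] := env_extP dgP.
have H s : hset (@uh F n) s -> invertible (env_ext dg s).
  move/(hset_morph eP); apply: hset_invertible => i j k ij /=; rewrite !dg_uh.
  exact: Eb_diff_invertible.
have [L1 L2] := loc_extP eP H.
by split; [exact_no_check L1 | exact_no_check L2].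
Qed.

Lemma O_algmap : algmap O. Proof. by case: OP. Qed.
Lemma O_hb i : O (hb F i) = E i i.
Proof. by case: OP => _ ->; rewrite dg_uh. Qed.

(** The adjoint weight, in the form that moves Cartan elements to the right; [wt_O] extends it from
    the [E i i] to all localized coefficients. *)
Definition wt (w : 'I_n -> int) (u : B) : Prop :=
  forall i, E i i * u = u * (E i i + (w i)%:~R).

Lemma wt_O w u f : wt w u -> O f * u = u * O (hshift w f).
Proof.
have P1 := @hshift_algmap F n w; have P2 := O_algmap.
move=> wu; move: f; apply: Uhbar_ind => [i|a|f g hf hg|f g hf hg|f g fg hf].
- by rewrite hshift_hb (algmapD P2) O_hb (algmap_int P2).
- by rewrite (algmap_cst P1) (algmap_cst P2) cstC.
- by rewrite (algmapD P1) !(algmapD P2) mulrDl mulrDr hf hg.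
- by rewrite (algmapM P1) !(algmapM P2) -mulrA hg !mulrA hf.
- have fg' := hshift_inv w fg.
  rewrite -[LHS]mulr1 -(algmap1 P2) -fg' (algmapM P2) mulrA -[_ * u * _]mulrA.
  by rewrite -hf !mulrA -(algmapM P2) [g * f]mulrC fg (algmap1 P2) mul1r.
Qed.

Lemma wt_O_right w u f : wt w u -> u * O f = O (hshift (fun i => - w i) f) * u.
Proof. by move=> wu; rewrite (wt_O _ wu) hshiftK. Qed.

Lemma wt_Eb a b : wt (fun i => (i == a)%:R - (i == b)%:R) (E a b).
Proof.
move=> i; apply/eqP; rewrite mulrDr -subr_eq0 opprD addrA Eb_comm.
have e (c : bool) : (c%:R : int)%:~R = c%:R :> B by case: c.
rewrite subr_eq0 intrD mulrDr mulrNz mulrN !e.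
rewrite [b == i]eq_sym; case: (eqVneq i a) => [->|ia]; case: (eqVneq _ b) => [<-|ib].
all: by rewrite ?mulr1 ?mulr0 ?mulr1n ?mulr0n.
Qed.

(** Only the existence of the shifted coefficient matters: it makes bar n_+ stable under right
    multiplication by the localized Cartan algebra. [O_Eb] does the same for n_- bar on the left. *)
Lemma Eb_O a b f : exists g, E a b * O f = O g * E a b.
Proof. by eexists; rewrite (wt_O_right _ (wt_Eb a b)); reflexivity. Qed.

Lemma O_Eb a b f : exists g, O f * E a b = E a b * O g.
Proof. by eexists; rewrite (wt_O _ (wt_Eb a b)); reflexivity. Qed.

Lemma wtM v w x y : wt v x -> wt w y -> wt (fun i => v i + w i) (x * y).
Proof.
move=> hx hy i.
have c : (v i)%:~R * y = y * (v i)%:~R by rewrite -(cst_int B) cstC.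
rewrite mulrA hx -mulrA mulrDl hy c intrD -mulrA -mulrDr.
by rewrite -addrA [(w i)%:~R + _]addrC.
Qed.

Lemma wtD w x y : wt w x -> wt w y -> wt w (x + y).
Proof. by move=> hx hy i; rewrite mulrDr mulrDl hx hy. Qed.

Lemma wt0 w : wt w 0. Proof. by move=> i; rewrite mulr0 mul0r. Qed.

Lemma wt_sum w (I : Type) (r : seq I) (Q : pred I) g :
  (forall i, Q i -> wt w (g i)) -> wt w (\sum_(i <- r | Q i) g i).
Proof.
by move=> h; apply: big_ind => //; [exact: wt0 | exact: wtD].
Qed.

Lemma wt_mulO w x f : wt w x -> wt w (x * O f).
Proof.
move=> hx i; rewrite mulrA hx -!mulrA; congr (_ * _).
rewrite -O_hb -!(algmap_int O_algmap) -!(algmapD O_algmap) -!(algmapM O_algmap).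
by rewrite mulrC.
Qed.

End BarAlgebra.

(** * The one-sided ideals n_- bar and bar n_+, and the double cosets *)

Section DoubleCosetFacts.
Variables (F : fieldType) (n : nat) (A : pzalgType F) (iota : 'M[F]_n -> A).
Hypothesis iotaP : liemap (@glbr F n) iota.
Local Notation U := (Uhbar F n).
Local Notation B := (bar iota).
Local Notation O := (of_Uhbar iota).
Local Notation E := (Eb iota).
Local Notation J := (in_bar_nplus (iota := iota)).
Local Notation K := (in_nminus_bar (iota := iota)).
Local Notation Npow := (in_bar_nplus_pow (iota := iota)).
Local Notation cosets := (cosets (iota := iota)).

Lemma bar_ind (Q : B -> Prop) :
  (forall a, Q (binj iota a)) ->
  (forall s b, hset (fun i => iota (delta_mx i i)) s ->
    binj iota s * b = 1 -> b * binj iota s = 1 -> Q b) ->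
  (forall u v, Q u -> Q v -> Q (u + v)) ->
  (forall u v, Q u -> Q v -> Q (u * v)) -> forall u, Q u.
Proof.
move=> Ql Qi QD QM.
have H := @loc_ind F A (hset (fun i => iota (delta_mx i i))) Q.
exact_no_check (H Ql Qi QD QM).
Qed.

Lemma npowMl k a u : Npow k u -> Npow k (a * u).
Proof.
elim: k a u => [//|k IH] a u /= [c ck ->]; exists (fun i j => a * c i j) => [i j|].
  exact: IH.
rewrite mulr_sumr; apply: eq_bigr => i _; rewrite mulr_sumr.
by apply: eq_bigr => j _; rewrite mulrA.
Qed.

Lemma npowD k u v : Npow k u -> Npow k v -> Npow k (u + v).
Proof.
elim: k u v => [//|k IH] u v /= [c ck ->] [d dk ->].
exists (fun i j => c i j + d i j) => [i j|]; first exact: IH.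
rewrite -big_split /=; apply: eq_bigr => i _; rewrite -big_split /=.
by apply: eq_bigr => j _; rewrite mulrDl.
Qed.

Lemma npow0 k : Npow k 0.
Proof.
elim: k => [//|k IH] /=; exists (fun _ _ => 0) => //.
by rewrite big1 // => i _; rewrite big1 // => j _; rewrite mul0r.
Qed.

Lemma npow_sum k (I : Type) (r : seq I) (Q : pred I) g :
  (forall i, Q i -> Npow k (g i)) -> Npow k (\sum_(i <- r | Q i) g i).
Proof. by move=> h; apply: big_ind => //; [exact: npow0 | exact: npowD]. Qed.

Lemma npow_Eb k a (i j : 'I_n) : (i < j)%N -> Npow k a -> Npow k.+1 (a * E i j).
Proof.
move=> ij ak; exists (fun i' j' => if (i' == i) && (j' == j) then a else 0).
  by move=> i' j'; case: ifP => // _; exact: npow0.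
rewrite (bigD1 i) //= (bigD1 j) //= !eqxx /= !big1 ?addr0 //.
  by move=> i' /negbTE ->; apply: big1 => j' _; rewrite mul0r.
by move=> j' /andP[_ /negbTE ->]; rewrite mul0r.
Qed.

Lemma npowS k u : Npow k.+1 u -> Npow k u.
Proof.
elim: k u => [//|k IH] u [c ck ->]; apply: npow_sum => i _.
by apply: npow_sum => j ij; apply: npow_Eb ij _; apply/IH/ck.
Qed.

Lemma npow_leq k m u : (k <= m)%N -> Npow m u -> Npow k u.
Proof.
move=> km; rewrite -(subnK km).
by elim: (m - k)%N => [//|d IH]; rewrite addSn => /npowS.
Qed.

Lemma npow_ind k (Q : B -> Prop) : Q 0 -> (forall u v, Q u -> Q v -> Q (u + v)) ->
  (forall a (i j : 'I_n), (i < j)%N -> Npow k a -> Q (a * E i j)) ->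
  forall u, Npow k.+1 u -> Q u.
Proof.
move=> Q0 QD QE u [c ck ->]; apply: big_ind => // i _.
by apply: big_ind => // j ij; apply: QE => //; apply: ck.
Qed.

Lemma npow1 u : J u <-> Npow 1 u.
Proof. by split=> [[c ->]|[c _ ->]]; [exists c | exists c]. Qed.

Lemma nplusD u v : J u -> J v -> J (u + v).
Proof. by rewrite !npow1; apply: npowD. Qed.
Lemma nplusMl a u : J u -> J (a * u).
Proof. by rewrite !npow1; apply: npowMl. Qed.
Lemma nplusN u : J u -> J (- u).
Proof. by rewrite -mulN1r; apply: nplusMl. Qed.
Lemma nplusB u v : J u -> J v -> J (u - v).
Proof. by move=> hu hv; apply/nplusD/nplusN. Qed.
Lemma nplus0 : J 0. Proof. by rewrite npow1; apply: npow0. Qed.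
Lemma nplus_Eb a (i j : 'I_n) : (i < j)%N -> J (a * E i j).
Proof. by rewrite npow1 => ij; apply: npow_Eb. Qed.
Lemma nplus_sum (I : Type) (r : seq I) (Q : pred I) g :
  (forall i, Q i -> J (g i)) -> J (\sum_(i <- r | Q i) g i).
Proof. by move=> h; rewrite npow1; apply: npow_sum => i /h; rewrite npow1. Qed.
Lemma nplus_ind (Q : B -> Prop) : Q 0 -> (forall u v, Q u -> Q v -> Q (u + v)) ->
  (forall a (i j : 'I_n), (i < j)%N -> Q (a * E i j)) -> forall u, J u -> Q u.
Proof.
move=> Q0 QD QE u; rewrite npow1; apply: (npow_ind Q0 QD) => a i j ij _.
exact: QE.
Qed.

Lemma npow_O k u f : Npow k u -> Npow k (u * O f).
Proof.
elim: k u f => [//|k IH] u f; move: u; apply: npow_ind => [|u v hu hv|a i j ij ak].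
- by rewrite mul0r; apply: npow0.
- by rewrite mulrDl; apply: npowD.
- have [g e] := Eb_O iotaP i j f; rewrite -mulrA e mulrA.
  by apply: npow_Eb => //; apply: IH.
Qed.

Lemma nplus_O u f : J u -> J (u * O f).
Proof. by rewrite !npow1; apply: npow_O. Qed.

Lemma nminus_ind (Q : B -> Prop) : Q 0 -> (forall u v, Q u -> Q v -> Q (u + v)) ->
  (forall a (i j : 'I_n), (j < i)%N -> Q (E i j * a)) -> forall u, K u -> Q u.
Proof.
move=> Q0 QD QE u [c ->]; apply: big_ind => // i _.
by apply: big_ind => // j ij; apply: QE.
Qed.

Lemma nminusMr u a : K u -> K (u * a).
Proof.
move=> [c ->]; exists (fun i j => c i j * a); rewrite mulr_suml.
by apply: eq_bigr => i _; rewrite mulr_suml; apply: eq_bigr => j _; rewrite mulrA.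
Qed.

Lemma nminusD u v : K u -> K v -> K (u + v).
Proof.
move=> [c ->] [d ->]; exists (fun i j => c i j + d i j).
rewrite -big_split /=; apply: eq_bigr => i _; rewrite -big_split /=.
by apply: eq_bigr => j _; rewrite mulrDr.
Qed.

Lemma nminus0 : K 0.
Proof.
exists (fun _ _ => 0).
by rewrite big1 // => i _; rewrite big1 // => j _; rewrite mulr0.
Qed.

Lemma nminus_Eb a (i j : 'I_n) : (j < i)%N -> K (E i j * a).
Proof.
move=> ij; exists (fun i' j' => if (i' == i) && (j' == j) then a else 0).
rewrite (bigD1 i) //= (bigD1 j) //= !eqxx /= !big1 ?addr0 //.
  by move=> i' /negbTE ->; apply: big1 => j' _; rewrite mulr0.
by move=> j' /andP[_ /negbTE ->]; rewrite mulr0.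
Qed.

Lemma nminus_O u f : K u -> K (O f * u).
Proof.
move: u; apply: nminus_ind => [|u v hu hv|a i j ij].
- by rewrite mulr0; apply: nminus0.
- by rewrite mulrDr; apply: nminusD.
- have [g e] := O_Eb iotaP i j f; rewrite mulrA e -mulrA.
  exact: nminus_Eb.
Qed.

Lemma in_cosets v w : K v -> J w -> v + w \in cosets.
Proof. by move=> hv hw; apply/asboolP; exists v, w. Qed.

Lemma nplus_cosets w : J w -> w \in cosets.
Proof. by move=> hw; rewrite -[w]add0r; apply: in_cosets => //; exact: nminus0. Qed.

Lemma nminus_cosets v : K v -> v \in cosets.
Proof. by move=> hv; rewrite -[v]addr0; apply: in_cosets => //; exact: nplus0. Qed.

Lemma cosets_O u f : u \in cosets -> u * O f \in cosets.
Proof.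
move=> /asboolP[v [w [hv hw ->]]]; rewrite mulrDl.
by apply: in_cosets; [apply: nminusMr | apply: nplus_O].
Qed.

Lemma O_cosets u f : u \in cosets -> O f * u \in cosets.
Proof.
move=> /asboolP[v [w [hv hw ->]]]; rewrite mulrDr.
by apply: in_cosets; [apply: nminus_O | apply: nplusMl].
Qed.

Lemma cls_eq (u v : B) : u - v \in cosets -> cls u = cls v.
Proof. by move=> h; apply/eqP; rewrite -Quotient.idealrBE. Qed.

Lemma cls_eqP (u v : B) : cls u = cls v -> u - v \in cosets.
Proof. by move/eqP; rewrite -Quotient.idealrBE. Qed.

Lemma clsD (u v : B) : cls (u + v) = cls u + cls v.
Proof. exact: raddfD. Qed.

Lemma rprK (x : red iota) : cls (rpr x) = x.
Proof. exact: reprK. Qed.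

End DoubleCosetFacts.

(** * Diamond products through highest weight representatives *)

Section Diamond.
Variables (F : fieldType) (n : nat) (A : pzalgType F) (iota : 'M[F]_n -> A).
Hypothesis iotaP : liemap (@glbr F n) iota.
Local Notation U := (Uhbar F n).
Local Notation B := (bar iota).
Local Notation O := (of_Uhbar iota).
Local Notation E := (Eb iota).
Local Notation J := (in_bar_nplus (iota := iota)).
Local Notation K := (in_nminus_bar (iota := iota)).
Local Notation Npow := (in_bar_nplus_pow (iota := iota)).
Local Notation cosets := (cosets (iota := iota)).

Lemma cls_O (u v : B) f : cls u = cls v -> cls (u * O f) = cls (v * O f).
Proof.
by move=> /cls_eqP uv; apply: cls_eq; rewrite -mulrBl; apply: cosets_O.
Qed.

Lemma ract_cls (u : B) f : ract (cls u) f = cls (u * O f).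
Proof. by apply: cls_O; rewrite rprK. Qed.

Lemma lact_cls (u : B) f : lact f (cls u) = cls (O f * u).
Proof.
apply: cls_eq; rewrite -mulrBr; apply: (O_cosets iotaP).
by apply: cls_eqP; rewrite rprK.
Qed.

(* Local nilpotency of the left action of n_+ on bar / bar n_+, in a form
   that is stable under products. *)
Definition ad_nilp (b : B) : Prop :=
  forall m, exists k, forall u, Npow k u -> Npow m (u * b).

Lemma nilpD b c : ad_nilp b -> ad_nilp c -> ad_nilp (b + c).
Proof.
move=> hb hc m; have [k kP] := hb m; have [l lP] := hc m.
exists (maxn k l) => u hu; rewrite mulrDr; apply: npowD.
- by apply/kP/(npow_leq _ hu)/leq_maxl.
- by apply/lP/(npow_leq _ hu)/leq_maxr.
Qed.

Lemma nilpM b c : ad_nilp b -> ad_nilp c -> ad_nilp (b * c).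
Proof.
move=> hb hc m; have [l lP] := hc m; have [k kP] := hb l.
by exists k => u hu; rewrite mulrA; apply/lP/kP.
Qed.

Lemma nilp_O f : ad_nilp (O f).
Proof. by move=> m; exists m => u; apply: npow_O. Qed.

Lemma nilp_cst a : ad_nilp (cst a).
Proof. by rewrite -(algmap_cst (O_algmap iotaP)); apply: nilp_O. Qed.

Lemma nilp0 : ad_nilp 0.
Proof. by rewrite -(algmap0 (O_algmap iotaP)); apply: nilp_O. Qed.

Lemma nilpN b : ad_nilp b -> ad_nilp (- b).
Proof.
move=> hb; rewrite -mulN1r -(cst1 (F := F)) -cstN.
by apply: nilpM => //; apply: nilp_cst.
Qed.

(** Since E b = b E + [E, b], the element b crosses the last root vector of a product at the price
    of one commutator, which the hypothesis controls. The power m is reached by induction, with a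
    bound common to the finitely many root vectors. *)
Lemma nilp_ad b : (forall i j : 'I_n, (i < j)%N -> ad_nilp (E i j * b - b * E i j)) ->
  ad_nilp b.
Proof.
move=> hb; elim=> [|m [k kP]]; first by exists 0%N.
have [g gP] : exists g : 'I_n * 'I_n -> nat, forall p : 'I_n * 'I_n, (p.1 < p.2)%N ->
    forall u, Npow (g p) u -> Npow m.+1 (u * (E p.1 p.2 * b - b * E p.1 p.2)).
  have [|g gP] := @choice _ _ (fun (p : 'I_n * 'I_n) k => (p.1 < p.2)%N ->
    forall u, Npow k u -> Npow m.+1 (u * (E p.1 p.2 * b - b * E p.1 p.2))).
    move=> p; have [/hb/(_ m.+1)[l lP]|] := boolP (p.1 < p.2)%N; last by exists 0%N.
    by exists l.
  by exists g.
exists (maxn k (\max_p g p)).+1; apply: npow_ind => [|u v hu hv|a i j ij ha].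
- by rewrite mul0r; apply: npow0.
- by rewrite mulrDl; apply: npowD.
- rewrite -mulrA -[E i j * b](subrK (b * E i j)) mulrDr; apply: npowD.
    apply: (gP (i, j)) => //; apply: npow_leq ha.
    by apply: leq_trans (leq_maxr _ _); apply: (leq_bigmax (i, j)).
  rewrite mulrA; apply: npow_Eb => //; apply: kP; apply: npow_leq ha.
  exact: leq_maxl.
Qed.

(** An inverse adjoined to A is thus the image of a localized Cartan element, and right
    multiplication by such an image preserves every power of n_+. *)
Lemma hset_O s : hset (fun i => iota (delta_mx i i)) s ->
  exists f g : U, f * g = 1 /\ O f = binj iota s.
Proof.
have bP := binj_algmap iota; have OP := O_algmap iotaP.
elim=> [|a i j k ij _ [f [g [fg e]]]].
  by exists 1, 1; rewrite mulr1 (algmap1 bP) (algmap1 OP).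
have [c [hc _]] := hb_invertible F k ij.
exists (f * (hb F i - hb F j + k%:~R)), (g * c); split.
  by rewrite mulrACA fg hc mulr1.
rewrite (algmapM bP) (algmapM OP) e (algmapD bP) (algmapD OP) (algmapB bP) (algmapB OP).
by rewrite !(O_hb iotaP) (algmap_int OP) (algmap_int bP).
Qed.

Hypothesis nilpA : forall a, ad_nilp (binj iota a).

Lemma nilp_bar b : ad_nilp b.
Proof.
have OP := O_algmap iotaP.
move: b; apply: bar_ind => [//|s b hs sb bs||]; [|exact: nilpD|exact: nilpM].
have [f [g [fg e]]] := hset_O hs.
suff -> : b = O g by apply: nilp_O.
by rewrite -[b]mulr1 -(algmap1 OP) -fg (algmapM OP) e mulrA bs mul1r.
Qed.

Local Notation G := (of_Ugbar iota).

Local Notation ext := (@env_ext F _ (@glbr F n) A iota).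

Let gP : algmap ext /\ forall u, ext (einj (@glbr F n) u) = iota u.
Proof. exact: env_extP. Qed.

Let GP : algmap G /\ forall a, G (binj _ a) = binj iota (ext a).
Proof.
have [eP eE] := gP; have bP := binj_algmap iota.
have fP := algmap_comp eP bP.
have H s : hset (fun i => einj (@glbr F n) (delta_mx i i)) s ->
    invertible ((binj iota \o ext) s).
  move/(hset_morph fP); apply: hset_invertible => i j k ij /=.
  by rewrite !eE; apply: Eb_diff_invertible.
have [L1 L2] := loc_extP fP H.
by split; [exact_no_check L1 | exact_no_check L2].
Qed.

Lemma G_algmap : algmap G. Proof. by case: GP. Qed.

Lemma G_Eb i j : G (Eb _ i j) = E i j.
Proof. by case: GP => _ ->; case: gP => _ ->. Qed.

Lemma G_npow k u : in_bar_nplus_pow k u -> Npow k (G u).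
Proof.
have P := G_algmap; elim: k u => [//|k IH] u [c ck ->].
exists (fun i j => G (c i j)) => [i j|]; first by apply/IH/ck.
rewrite (algmap_sum P).
apply: eq_bigr => i _; rewrite (algmap_sum P).
by apply: eq_bigr => j _; rewrite (algmapM P) G_Eb.
Qed.

Lemma nplus_hw u y : (forall i j : 'I_n, (i < j)%N -> J (E i j * y)) ->
  J u -> J (u * y).
Proof.
move=> hy; move: u; apply: nplus_ind => [|v w hv hw|a i j ij].
- by rewrite mul0r; exact: nplus0.
- by rewrite mulrDl; apply: nplusD.
- by rewrite -mulrA; apply/nplusMl/hy.
Qed.

Variable P : fseries F n.
Hypothesis P_extremal : extremal_projector P.

(** The vanishing of P n_- says only that a late partial sum times [E i j] lies in bar n_+^k. Taking
    k from the local nilpotency of the remaining factor [a] brings the whole product into bar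
    n_+. *)
Lemma psum_kills_nminus u : K u ->
  exists M0, forall M, (M0 <= M)%N -> J (G (psum P M) * u).
Proof.
have GPa := G_algmap; have [_ P2 _ _ _] := P_extremal.
move: u; apply: nminus_ind => [|u v [M1 h1] [M2 h2]|a i j ij].
- by exists 0%N => M _; rewrite mulr0; exact: nplus0.
- exists (maxn M1 M2) => M; rewrite geq_max => /andP[h3 h4].
  by rewrite mulrDr; apply: nplusD; [apply: h1 | apply: h2].
- have [k kP] := nilp_bar a 1.
  have Yn : nminus (delta_mx i j : 'M[F]_n).
    move=> i' j' ij'; rewrite mxE; case: andP => // -[/eqP ei /eqP ej].
    by move: ij'; rewrite ei ej leqNgt ij.
  have [M0 hM0] := P2 _ Yn k; exists M0 => M /hM0 /G_npow h.
  by rewrite mulrA; apply/npow1/kP; rewrite -G_Eb -(algmapM GPa).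
Qed.

(** A nonempty partial sum p is 1 modulo bar n_+, and y is annihilated by n_+ modulo bar n_+, so p y
    = y modulo bar n_+. The n_- part of the right representative is killed by late partial sums. *)
Lemma diamond_cls (u v y : B) :
  (forall i j : 'I_n, (i < j)%N -> J (E i j * y)) -> v - y \in cosets ->
  diamond P (cls u) (cls v) = cls (u * y).
Proof.
move=> hy vy; have GPa := G_algmap; have [_ _ _ P4 _] := P_extremal.
set a := rpr (cls u); set b := rpr (cls v).
have /asboolP[k1 [j1 [k1K j1J ea]]] : a - u \in cosets by apply: cls_eqP; rewrite rprK.
have /asboolP[k2 [j2 [k2K j2J eb]]] : b - y \in cosets.
  by rewrite -[b](subrK v) -addrA rpredD //; apply: cls_eqP; rewrite rprK.
have [M0 hM0] := psum_kills_nminus k2K.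
(* The empty partial sum is 0 and the congruence to 1 holds from [psum P 1] on, hence [M0.+1]. *)
suff H M : (M0.+1 <= M)%N -> cls (a * G (psum P M) * b) = cls (u * y).
  apply: classical_sets.xget_unique; first by exists M0.+1 => M /H.
  move=> z [M1 hM1]; rewrite -(H (maxn M0.+1 M1)) ?leq_maxl //.
  by rewrite hM1 ?leq_maxr.
case: M => [//|M] hM; set p := G _; apply: cls_eq.
have p1 : J (p - 1).
  have [c hc] := P4 M; rewrite /p -(algmap1 GPa) -(algmapB GPa) hc.
  exists (fun i j => G (c i j)); rewrite (algmap_sum GPa); apply: eq_bigr => i _.
  by rewrite (algmap_sum GPa); apply: eq_bigr => j _; rewrite (algmapM GPa) G_Eb.
(* Here k1 and k2 lie in n_- bar, j1 and j2 in bar n_+. The first summand is in n_- bar. The others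
   are in bar n_+: p k2 by the choice of [M0], and (p - 1) y and j1 y because y is a highest weight
   vector. *)
have -> : a * p * b - u * y = k1 * (p * (y + k2))
    + (a * p * j2 + (u + j1) * (p * k2) + (u + j1) * ((p - 1) * y) + j1 * y).
  have eb' : b = y + k2 + j2 by rewrite -addrA -eb addrC subrK.
  have ea' : a = k1 + (u + j1) by rewrite addrCA -ea addrC subrK.
  have e1 : a * p * b = a * p * (y + k2) + a * p * j2 by rewrite eb' mulrDr.
  have e2 : a * p * (y + k2) = k1 * (p * (y + k2)) + (u + j1) * (p * (y + k2)).
    by rewrite ea' -mulrA mulrDl.
  have e3 : (u + j1) * (p * (y + k2)) = (u + j1) * ((p - 1) * y) + (u * y + j1 * y)
      + (u + j1) * (p * k2).
    have -> : u * y + j1 * y = (u + j1) * y by rewrite mulrDl.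
    by rewrite mulrBl mul1r -mulrDr subrK -mulrDr -mulrDr.
  apply/eqP; rewrite subr_eq e1 e2 e3 !addrA; apply/eqP.
  by rewrite (ACl (1*6*5*2*4*3)%AC).
apply: in_cosets; first exact: nminusMr.
apply: nplusD; last exact: nplus_hw.
apply: nplusD; last by apply/nplusMl/nplus_hw.
apply: nplusD; first exact: nplusMl.
by apply/nplusMl/hM0; apply: ltnW.
Qed.

End Diamond.

(** * Highest weight vectors from the matrix of generators *)

Section HighestWeightVectors.
Variables (F : fieldType) (n : nat) (A : pzalgType F) (iota : 'M[F]_n -> A).
Hypothesis iotaP : liemap (@glbr F n) iota.
Local Notation U := (Uhbar F n).
Local Notation B := (bar iota).
Local Notation O := (of_Uhbar iota).
Local Notation J := (in_bar_nplus (iota := iota)).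
Local Notation K := (in_nminus_bar (iota := iota)).
Local Notation cosets := (cosets (iota := iota)).
Local Notation cls := (cls (iota := iota)).

(* e is either the standard basis or its image under the automorphism
   e_ij |-> - e_{n+1-j,n+1-i}, which exchanges the vector representation with
   its dual and preserves the triangular decomposition. *)
Variables (e : 'I_n -> 'I_n -> B) (kappa : nat -> U).
Hypothesis e_comm : forall a b c d,
  e a b * e c d - e c d * e a b = e a d *+ (b == c) - e c b *+ (d == a).
Hypothesis e_diag : forall j : 'I_n, O (kappa j) = e j j + (n - j)%:R.
Hypothesis e_nplus : forall a b : 'I_n, (a < b)%N -> J (e a b).
Hypothesis e_nminus : forall (a b : 'I_n) u, (b < a)%N -> K (e a b * u).
Hypothesis kappa_inv : forall i j : 'I_n, i != j -> invertible (kappa i - kappa j).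

Variable v : 'I_n -> B.
Hypothesis v_cov : forall a b j, e a b * v j - v j * e a b = v a *+ (b == j).

Let OP := O_algmap iotaP.

Fixpoint chain (m : nat) : 'I_n -> B :=
  if m is m'.+1 then
    fun j => \sum_i e j i * chain m' i - chain m' j * O (kappa m')
  else v.

Let eM a b c d : e a b * e c d = e c d * e a b + (e a d *+ (b == c) - e c b *+ (d == a)).
Proof. by rewrite -e_comm addrC subrK. Qed.

Let diagO a f : e a a * O f = O f * e a a.
Proof.
have -> : e a a = O (kappa a - (n - a)%:R).
  by rewrite (algmapB OP) (algmap_nat OP) e_diag addrK.
by rewrite -!(algmapM OP) mulrC.
Qed.

Let mulr_sum_delta (w : B) (f : 'I_n -> B) b : \sum_i f i * (w *+ (b == i)) = f b * w.
Proof.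
rewrite (bigD1 b) //= eqxx mulr1n big1 ?addr0 // => i /negbTE ib.
by rewrite eq_sym ib mulr0n mulr0.
Qed.

(** Invariance of the matrix of generators: the defect of covariance of E f is E applied to the
    defect of f, so it stays in any left ideal that contains the latter. *)
Let sum_commute a b j (f : 'I_n -> B) :
  e a b * \sum_i e j i * f i = \sum_i e j i * (e a b * f i - f a *+ (b == i))
    + (\sum_i e a i * f i) *+ (b == j).
Proof.
rewrite mulr_sumr -sumrMnl.
have -> : \sum_i e j i * (e a b * f i - f a *+ (b == i))
    = \sum_i e j i * e a b * f i - e j b * f a.
  rewrite -(mulr_sum_delta (f a)) -sumrB; apply: eq_bigr => i _.
  by rewrite mulrBr mulrA.
have -> : e j b * f a = \sum_i (e j b *+ (i == a)) * f i.
  rewrite (bigD1 a) //= eqxx big1 ?addr0 // => i /negbTE ->.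
  by rewrite mulr0n mul0r.
rewrite -sumrB -big_split /=; apply: eq_bigr => i _.
by rewrite mulrA eM mulrDl mulrBl mulrnAl addrA addrAC.
Qed.

Lemma chain_cov m (a b j : 'I_n) : (a < b)%N ->
  J (e a b * chain m j - chain m a *+ (b == j)).
Proof.
move=> ab; elim: m j => [|m IH] j /=.
  by rewrite -(v_cov a b j) opprB addrC subrK; apply/nplusMl/e_nplus.
rewrite mulrBr sum_commute mulrnBl mulrA -mulrnAl.
rewrite opprB !addrA (ACl (1*(4*3)*(2*5))%AC) /= subrr addr0.
rewrite -opprB -mulrBl.
apply: nplusB; last exact: nplus_O.
by apply: nplus_sum => i _; apply: nplusMl.
Qed.

(** Exact, and not only modulo bar n_+, because [e a a] commutes with the coefficients. It serves to
    move [e j j] to the right in [chain_step]. *)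
Lemma chain_wt m a j :
  e a a * chain m j = chain m j * e a a + chain m a *+ (a == j).
Proof.
elim: m j => [|m IH] j /=; first by rewrite -v_cov addrC subrK.
rewrite mulrBr sum_commute mulrA IH mulrBl mulrnBl.
have -> : \sum_i e j i * (e a a * chain m i - chain m a *+ (a == i))
    = (\sum_i e j i * chain m i) * e a a.
  by rewrite mulr_suml; apply: eq_bigr => i _; rewrite IH addrK mulrA.
rewrite mulrDl -mulrA diagO mulrA -mulrnAl.
by rewrite opprD !addrA (ACl (1*3*2*4)%AC).
Qed.

(** For i > j the generator e_ji raises, so by covariance e_ji times coordinate i is coordinate j
    modulo bar n_+; the diagonal generator gives coordinate j times e_jj + 1. With n - j - 1 indices
    above j, counted from 0, the total factor is e_jj + n - j, which is the origin of [kappa]. *)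
Lemma chain_step m j :
  J (chain m.+1 j - (\sum_(i < n | (i < j)%N) e j i * chain m i
                     + chain m j * O (kappa j - kappa m))).
Proof.
rewrite /= (algmapB OP) mulrBr.
set S := \sum_(i < n | (i < j)%N) _.
rewrite (bigID (fun i : 'I_n => (i < j)%N)) /= -/S (bigID (fun i : 'I_n => i == j)) /=.
have -> : \sum_(i < n | ~~ (i < j)%N && (i == j)) e j i * chain m i
    = chain m j * e j j + chain m j.
  rewrite (big_pred1 j) => [|i /=]; first by rewrite chain_wt eqxx.
  by rewrite andbC; case: eqP => //= ->; rewrite ltnn.
set T := \sum_(i < n | _) _.
have -> : chain m j * O (kappa j) = chain m j * e j j + chain m j *+ (n - j).
  by rewrite e_diag mulrDr mulr_natr.
have e1 : \sum_(i < n | ~~ (i < j)%N && (i != j)) chain m j + chain m j = chain m j *+ (n - j).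
  rewrite (eq_bigl (fun i : 'I_n => (j < i)%N)); last first.
    by move=> i; rewrite -leqNgt ltn_neqAle andbC eq_sym.
  rewrite -(big_mkord (fun i => j < i)%N (fun _ => chain m j)).
  rewrite -(big_nat_widenl _ _ _ (fun _ => true)) // sumr_const_nat.
  by rewrite -mulrSr subnSK.
rewrite -e1.
have -> : forall a b c d t s : B, a + (b + c + t) - d - (a + (b + (s + c) - d)) = t - s.
  move=> a b c d t s; rewrite !opprD opprK !addrA.
  rewrite (ACl ((1*6)*(2*7)*(3*9)*(5*10)*(4*8))%AC) /= !subrr addNr !add0r; by [].
rewrite -sumrB; apply: nplus_sum => i /andP[ij ji].
have := @chain_cov m j i i; rewrite eqxx; apply.
by rewrite ltn_neqAle eq_sym ji leqNgt.
Qed.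

Lemma chain_zero m (j : 'I_n) : (j < m)%N -> J (chain m j).
Proof.
elim: m j => [//|m IH] j jm.
rewrite -[chain m.+1 j](subrK (\sum_(i < n | (i < j)%N) e j i * chain m i
  + chain m j * O (kappa j - kappa m))).
apply: nplusD; first exact: chain_step.
apply: nplusD.
  by apply: nplus_sum => i ij; apply/nplusMl/IH; apply: leq_trans ij _.
move: jm; rewrite ltnS leq_eqVlt => /predU1P[->|jm]; last exact/nplus_O/IH.
by rewrite subrr (algmap0 OP) mulr0; exact: nplus0.
Qed.

(** By [chain_cov] the only obstruction arises for b = j and is coordinate a < j, which j steps have
    annihilated. *)
Lemma chain_hw (a b j : 'I_n) : (a < b)%N -> J (e a b * chain j j).
Proof.
move=> ab; rewrite -[_ * _](subrK (chain j a *+ (b == j))).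
apply: nplusD; first exact: chain_cov.
case: eqP => [bj|_]; last by rewrite mulr0n; exact: nplus0.
by rewrite mulr1n; apply: chain_zero; rewrite -bj.
Qed.

(** The scalar by which m steps multiply coordinate j modulo n_- bar and bar n_+. At m = j every
    factor is invertible, which permits normalization. *)
Definition kprod m (j : 'I_n) : U := \prod_(r < m) (kappa j - kappa r).

Lemma kprodS m j : kprod m.+1 j = kprod m j * (kappa j - kappa m).
Proof. exact: big_ord_recr. Qed.

Lemma kprod_inv (j : 'I_n) : invertible (kprod j j).
Proof.
apply: (big_ind (@invertible U)) => [||r _]; first by exists 1; rewrite mulr1.
  by move=> x y; apply: invertibleM.
have rn := ltn_trans (ltn_ord r) (ltn_ord j).
apply: (kappa_inv (j := Ordinal rn)); apply/eqP => /(congr1 val) /= jr.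
by have := ltn_ord r; rewrite -jr ltnn.
Qed.

Lemma cls_sum (I : Type) (r : seq I) (Q : pred I) (f : I -> B) :
  cls (\sum_(i <- r | Q i) f i) = \sum_(i <- r | Q i) cls (f i).
Proof. exact: raddf_sum. Qed.

Lemma cls_nplus x y : J (x - y) -> cls x = cls y.
Proof. by move=> h; apply/cls_eq/nplus_cosets. Qed.

Lemma cls_nminus (x : B) : K x -> cls x = cls 0.
Proof. by move=> h; apply/cls_eq; rewrite subr0; apply: nminus_cosets. Qed.

Lemma chain_step_cls g m j : cls (g * chain m.+1 j) =
  \sum_(i < n | (i < j)%N) cls (g * e j i * chain m i)
    + cls (g * chain m j * O (kappa j - kappa m)).
Proof.
rewrite -cls_sum -clsD; apply: cls_nplus.
have -> : \sum_(i < n | (i < j)%N) g * e j i * chain m i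
    + g * chain m j * O (kappa j - kappa m)
    = g * (\sum_(i < n | (i < j)%N) e j i * chain m i + chain m j * O (kappa j - kappa m)).
  by rewrite mulrDr mulr_sumr mulrA; congr (_ + _); apply: eq_bigr => i _; rewrite mulrA.
by rewrite -mulrBr; apply/nplusMl/chain_step.
Qed.

Lemma chain_cls m j : cls (chain m j) = cls (v j * O (kprod m j)).
Proof.
elim: m => [|m IH]; first by rewrite /kprod big_ord0 (algmap1 OP) mulr1.
rewrite -[chain m.+1 j]mul1r chain_step_cls big1 ?add0r => [|i ij].
  by rewrite mul1r kprodS (algmapM OP) mulrA; apply: (cls_O iotaP).
by rewrite mul1r cls_nminus; [exact: raddf0 | exact: e_nminus].
Qed.

(** A lowering generator brought to the far left disappears from the class, so only its commutator
    with g survives. All the pairings below reduce to this. *)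
Lemma cls_lower (g w c : B) (a b : 'I_n) : (b < a)%N ->
  g * e a b - e a b * g = w -> cls (g * e a b * c) = cls (w * c).
Proof.
move=> ba ge; apply: cls_eq; apply: nminus_cosets.
by rewrite -mulrBl -ge opprB addrC subrK -mulrA; apply: e_nminus.
Qed.

Section SameType.
Variable g : 'I_n -> B.
Hypothesis g_cov : forall i a b, g i * e a b - e a b * g i = - g a *+ (i == b).

Lemma chain_same_ge m (i j : 'I_n) : (j <= i)%N ->
  cls (g i * chain m j) = cls (g i * v j * O (kprod m j)).
Proof.
move=> ji; elim: m => [|m IH]; first by rewrite /kprod big_ord0 (algmap1 OP) mulr1.
rewrite chain_step_cls big1 ?add0r => [|l lj].
  by rewrite kprodS (algmapM OP) mulrA; apply: (cls_O iotaP).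
rewrite (cls_lower _ lj (g_cov i j l)) (_ : (i == l) = false).
  by rewrite mulr0n mul0r; exact: raddf0.
by apply/negP => /eqP il; move: lj; rewrite -il ltnNge ji.
Qed.

(** A step couples the pairing of g_i with coordinate j to that of g_j with coordinate i. The
    combination on the left is the eigenvector of this triangular system of size 2 with eigenvalue
    kappa_j - kappa_m, so each step only multiplies it by that scalar. *)
Lemma chain_same_lt m (i j : 'I_n) : (i < j)%N ->
  cls (g i * chain m j * O (kappa i - kappa j) + g j * chain m i)
  = cls ((g i * v j * O (kappa i - kappa j) + g j * v i) * O (kprod m j)).
Proof.
move=> ij; elim: m => [|m IH].
  by rewrite /kprod big_ord0 (algmap1 OP) mulr1.
have S1 : cls (g i * chain m.+1 j)
    = cls (- g j * chain m i + g i * chain m j * O (kappa j - kappa m)).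
  rewrite chain_step_cls clsD; congr (_ + _).
  rewrite (bigD1 i) //= (cls_lower _ ij (g_cov i j i)) eqxx mulr1n big1 ?addr0 //.
  move=> l /andP[lj li]; rewrite (cls_lower _ lj (g_cov i j l)) eq_sym (negbTE li).
  by rewrite mulr0n mul0r; exact: raddf0.
have S2 : cls (g j * chain m.+1 i) = cls (g j * chain m i * O (kappa i - kappa m)).
  rewrite chain_step_cls big1 ?add0r // => l li.
  rewrite (cls_lower _ li (g_cov j i l)) (_ : (j == l) = false).
    by rewrite mulr0n mul0r; exact: raddf0.
  by apply/negP => /eqP jl; move: li; rewrite -jl ltnNge (ltnW ij).
rewrite clsD (cls_O iotaP _ S1) S2 -clsD kprodS (algmapM OP) [in RHS]mulrA.
rewrite -(cls_O iotaP _ IH); congr cls.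
have -> : O (kappa i - kappa m) = O (kappa i - kappa j) + O (kappa j - kappa m).
  by rewrite -(algmapD OP) addrA subrK.
have ad : O (kappa j - kappa m) * O (kappa i - kappa j)
    = O (kappa i - kappa j) * O (kappa j - kappa m).
  by rewrite -!(algmapM OP) mulrC.
rewrite mulNr !mulrDl mulNr mulrDr -!mulrA ad addrACA addNr add0r.
by rewrite !mulrA.
Qed.

End SameType.

Section OppositeType.
Variable g : 'I_n -> B.
Hypothesis g_cov : forall i a b, g i * e a b - e a b * g i = g b *+ (i == a).

Lemma chain_opp_ne m (i j : 'I_n) : i != j ->
  cls (g i * chain m j) = cls (g i * v j * O (kprod m j)).
Proof.
move=> ij; elim: m => [|m IH]; first by rewrite /kprod big_ord0 (algmap1 OP) mulr1.
rewrite chain_step_cls big1 ?add0r => [|l lj].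
  by rewrite kprodS (algmapM OP) mulrA; apply: (cls_O iotaP).
rewrite (cls_lower _ lj (g_cov i j l)) (negbTE ij).
by rewrite mulr0n mul0r; exact: raddf0.
Qed.

(** A step multiplies the pairing of g_a with coordinate a by kappa_a - kappa_m and adds the
    pairings of all l < a. The hypothesis says that r is a left eigenvector of this triangular
    matrix, with eigenvalue kappa_j - kappa_m. *)
Lemma chain_opp_eq m (j : 'I_n) (r : 'I_n -> U) :
  (forall a : 'I_n, r a * (kappa a - kappa j) + \sum_(b < n | (a < b)%N) r b = 0) ->
  cls (\sum_a g a * chain m a * O (r a))
  = cls ((\sum_a g a * v a * O (r a)) * O (kprod m j)).
Proof.
move=> rP; elim: m => [|m IH].
  by rewrite /kprod big_ord0 (algmap1 OP) mulr1.
rewrite kprodS (algmapM OP) [in RHS]mulrA -(cls_O iotaP _ IH) mulr_suml !cls_sum.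
have S1 a : cls (g a * chain m.+1 a * O (r a)) =
    \sum_(l < n | (l < a)%N) cls (g l * chain m l * O (r a))
    + cls (g a * chain m a * O (r a * (kappa a - kappa m))).
  have h : cls (g a * chain m.+1 a) = cls (\sum_(l < n | (l < a)%N) g l * chain m l
      + g a * chain m a * O (kappa a - kappa m)).
    rewrite chain_step_cls clsD cls_sum; congr (_ + _).
    by apply: eq_bigr => l la; rewrite (cls_lower _ la (g_cov a a l)) eqxx mulr1n.
  rewrite (cls_O iotaP _ h) mulrDl clsD mulr_suml cls_sum -mulrA -(algmapM OP).
  by rewrite [r a * _]mulrC.
rewrite (eq_bigr _ (fun a _ => S1 a)) big_split /=.
rewrite (exchange_big_dep xpredT) //= -big_split /=.
apply: eq_bigr => l _; rewrite -cls_sum -clsD -mulr_sumr -(algmap_sum OP) -mulrDr.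
rewrite -(algmapD OP) -[in RHS]mulrA -[in RHS](algmapM OP); congr (cls (_ * O _)).
by have := rP l; rewrite addrC => /eqP; rewrite addr_eq0 => /eqP ->; ring.
Qed.

End OppositeType.

(* The vector Y j is the image of v j under the extremal projector, modulo
   bar n_+. *)
Lemma hw_vector : exists Y : 'I_n -> B,
  [/\ forall a b j : 'I_n, (a < b)%N -> J (e a b * Y j),
      forall j, cls (v j) = cls (Y j),
      forall a j, e a a * Y j = Y j * e a a + Y a *+ (a == j),
      forall g : 'I_n -> B,
        (forall i a b, g i * e a b - e a b * g i = - g a *+ (i == b)) ->
        (forall i j : 'I_n, (j <= i)%N -> cls (g i * Y j) = cls (g i * v j)) /\
        (forall (i j : 'I_n) q, (i < j)%N -> (kappa i - kappa j) * q = 1 ->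
           cls (g i * Y j) = cls (g i * v j + g j * v i * O q))
    & forall g : 'I_n -> B,
        (forall i a b, g i * e a b - e a b * g i = g b *+ (i == a)) ->
        (forall i j, i != j -> cls (g i * Y j) = cls (g i * v j)) /\
        (forall (j : 'I_n) (r : 'I_n -> U),
           (forall a : 'I_n, r a * (kappa a - kappa j) + \sum_(b < n | (a < b)%N) r b = 0) ->
           r j = 1 -> (forall a : 'I_n, (j < a)%N -> r a = 0) ->
           cls (g j * Y j) = cls (\sum_a g a * v a * O (r a)))].
Proof.
have pinv (j : 'I_n) : kprod j j * rinv (kprod j j) = 1.
  by have [] := rinvP (kprod_inv j).
have cancel_pi (x y : B) (j : 'I_n) : cls x = cls (y * O (kprod j j)) ->
    cls (x * O (rinv (kprod j j))) = cls y.
  by move=> h; rewrite (cls_O iotaP _ h) -mulrA -(algmapM OP) pinv (algmap1 OP) mulr1.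
exists (fun j : 'I_n => chain j j * O (rinv (kprod j j))); split.
- by move=> a b j ab; rewrite mulrA; apply: (nplus_O iotaP); apply: chain_hw.
- by move=> j; apply/esym/cancel_pi/chain_cls.
- move=> a j; rewrite mulrA chain_wt mulrDl -mulrA diagO mulrA; congr (_ + _).
  by case: eqP => [->|]; rewrite ?mulr1n ?mulr0n ?mul0r.
- move=> g gP; split=> [i j ji|i j q ij kq].
    by rewrite mulrA; apply/cancel_pi/chain_same_ge.
  have h := chain_same_lt gP j ij.
  (* After j steps coordinate i < j has vanished, so the eigenvector is reduced to its first
     term. *)
  have hj : cls (g j * chain j i) = cls 0.
    by apply: cls_nplus; rewrite subr0; apply/nplusMl/chain_zero.
  have {h hj}/cancel_pi h : cls (g i * chain j j * O (kappa i - kappa j))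
      = cls ((g i * v j * O (kappa i - kappa j) + g j * v i) * O (kprod j j)).
    by rewrite -h clsD hj -clsD addr0.
  have := cls_O iotaP q h; rewrite mulrDl -!mulrA -!(algmapM OP) kq (algmap1 OP) mulr1.
  by rewrite mulrCA kq mulr1.
- move=> g gP; split=> [i j ij|j r rP r1 r0].
    by rewrite mulrA; apply/cancel_pi/chain_opp_ne.
  rewrite mulrA; apply: cancel_pi; rewrite -(chain_opp_eq gP j rP).
  (* Only a = j survives in the eigenvector: r vanishes beyond j, and j steps have annihilated the
     coordinates before j. *)
  rewrite (bigD1 j) //= r1 (algmap1 OP) mulr1 clsD cls_sum big1 ?addr0 // => a aj.
  have [ja|aj'] := ltnP j a; first by rewrite r0 // (algmap0 OP) mulr0; exact: raddf0.
  rewrite (@cls_nplus _ 0) ?subr0; first exact: raddf0.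
  apply: (nplus_O iotaP); apply: nplusMl; apply: chain_zero.
  by rewrite ltn_neqAle aj' andbT; apply: contra aj => /eqP/val_inj ->.
Qed.

End HighestWeightVectors.

(** * Tensor products and the enveloping algebra *)

Section TensorFacts.
Variables (F : fieldType) (A B : pzalgType F).
Local Notation T := (tensor A B).

Definition tensl (a : A) : T := tens a 1.
Definition tensr (b : B) : T := tens 1 b.
Let gl (a : A) : T := gen (@commuting_pair F A B) (inl a).
Let gr (b : B) : T := gen (@commuting_pair F A B) (inr b).

Let glP : algmap gl. Proof. by case: (tensor_genP A B) => h _ _; exact: h. Qed.
Let grP : algmap gr. Proof. by case: (tensor_genP A B) => _ h _; exact: h. Qed.

Let tenslE : tensl =1 gl.
Proof. by move=> a; rewrite -[RHS]mulr1 -(algmap1 grP). Qed.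

Let tensrE : tensr =1 gr.
Proof. by move=> b; rewrite -[RHS]mul1r -(algmap1 glP). Qed.

Lemma tensl_algmap : algmap tensl.
Proof.
by split=> *; rewrite !tenslE ?(algmapD glP) ?(algmapM glP) ?(algmap_cst glP).
Qed.

Lemma tensr_algmap : algmap tensr.
Proof.
by split=> *; rewrite !tensrE ?(algmapD grP) ?(algmapM grP) ?(algmap_cst grP).
Qed.

Lemma tensl_tensr a b : tensl a * tensr b = tensr b * tensl a.
Proof. by rewrite !tenslE !tensrE; case: (tensor_genP A B) => _ _ h; exact: h. Qed.

Lemma tensor_ind (Q : T -> Prop) : (forall a, Q (tensl a)) -> (forall b, Q (tensr b)) ->
  (forall u v, Q u -> Q v -> Q (u + v)) -> (forall u v, Q u -> Q v -> Q (u * v)) ->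
  forall u, Q u.
Proof.
move=> Ql Qr QD QM.
have Qg x : Q (gen (@commuting_pair F A B) x).
  by case: x => [a|b]; [have := Ql a; rewrite tenslE | have := Qr b; rewrite tensrE].
have Qc a : Q (cst a) by rewrite -(algmap_cst tensl_algmap).
have QN u : Q u -> Q (- u).
  by move=> Qu; rewrite -mulN1r -(cst1 (F := F)) -cstN; apply: QM.
have H := @uni_ind F _ (@commuting_pair F A B) Q.
exact_no_check (H Qg Qc QN QD QM).
Qed.

End TensorFacts.

Section EnvelopingFacts.
Variables (F : fieldType) (n : nat).

Definition uinj : 'M[F]_n -> Ugl F n := einj _.

Lemma uinj_liemap : liemap (@glbr F n) uinj.
Proof. exact: einj_liemap. Qed.

Lemma Ugl_ind (Q : Ugl F n -> Prop) : (forall X, Q (uinj X)) -> (forall a, Q (cst a)) ->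
  (forall u, Q u -> Q (- u)) ->
  (forall u v, Q u -> Q v -> Q (u + v)) -> (forall u v, Q u -> Q v -> Q (u * v)) ->
  forall u, Q u.
Proof.
move=> Qg Qc QN QD QM.
have H := @uni_ind F _ (@liemap F _ (@glbr F n)) Q.
exact_no_check (H Qg Qc QN QD QM).
Qed.

End EnvelopingFacts.

(** * Commutators of differential operators *)

Section Commutators.
Variable A : pzRingType.

Definition commutator (u v : A) := u * v - v * u.

Lemma comMr u v w : commutator u (v * w) = commutator u v * w + v * commutator u w.
Proof. by rewrite /commutator mulrBl mulrBr !mulrA addrA subrK. Qed.
Lemma comMl u v w : commutator (u * v) w = commutator u w * v + u * commutator v w.
Proof. by rewrite /commutator mulrBl mulrBr !mulrA [RHS]addrC addrA subrK. Qed.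
Lemma comDl u v w : commutator (u + v) w = commutator u w + commutator v w.
Proof. by rewrite /commutator mulrDl mulrDr opprD addrACA. Qed.
Lemma com0r u : commutator u 0 = 0. Proof. by rewrite /commutator mulr0 mul0r subrr. Qed.
Lemma com0l u : commutator 0 u = 0. Proof. by rewrite /commutator mulr0 mul0r subrr. Qed.
Lemma comDr u v w : commutator u (v + w) = commutator u v + commutator u w.
Proof. by rewrite /commutator mulrDl mulrDr opprD addrACA. Qed.
Lemma com_sumr u (I : Type) (r : seq I) (Q : pred I) g :
  commutator u (\sum_(i <- r | Q i) g i) = \sum_(i <- r | Q i) commutator u (g i).
Proof. exact: (big_morph _ (comDr u) (com0r u)). Qed.
Lemma com_suml u (I : Type) (r : seq I) (Q : pred I) g :
  commutator (\sum_(i <- r | Q i) g i) u = \sum_(i <- r | Q i) commutator (g i) u.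
Proof. exact: (big_morph (commutator^~ u) (fun v w => comDl v w u) (com0l u)). Qed.

End Commutators.

Lemma com_cstl (F : fieldType) (A : pzalgType F) (a : F) (u v : A) :
  commutator (cst a * u) v = cst a * commutator u v.
Proof. by rewrite /commutator mulrBr !mulrA (cstC a v). Qed.

Section DifferentialOperators.
Variables (F : fieldType) (n N : nat).
Local Notation Diff := (Diff F n N).
Local Notation x := (@xvar F n N).
Local Notation d := (@dvar F n N).

Lemma mxvec_index_eq (i j : 'I_n) (a b : 'I_N) :
  (mxvec_index i a == mxvec_index j b) = (i == j) && (a == b).
Proof.
apply/eqP/andP => [|[/eqP-> /eqP->]] //.
by move=> /cast_ord_inj/enum_rank_inj [-> ->].
Qed.

Lemma com_xx i a j b : commutator (x i a) (x j b) = 0.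
Proof.
apply/eqP; rewrite subr_eq0; apply/eqP.
by apply: diffop_eq => p /=; rewrite mulrCA.
Qed.

Lemma com_dd i a j b : commutator (d i a) (d j b) = 0.
Proof.
apply/eqP; rewrite subr_eq0; apply/eqP.
by apply: diffop_eq => p /=; rewrite mderiv_comm.
Qed.

Lemma mderiv_var m (i j : 'I_m) : mderiv i ('X_j : {mpoly F[m]}) = (i == j)%:R.
Proof.
rewrite mderivX mnm1E eq_sym; case: eqP => [->|_]; last by rewrite scale0r.
rewrite scale1r (_ : (_ - _)%MM = 0%MM) ?mpolyX0 //.
by apply/mnmP => k; rewrite mnmBE subnn mnm0E.
Qed.

Lemma com_dx j b i a : commutator (d j b) (x i a) = ((i == j) && (a == b))%:R.
Proof.
apply/eqP; rewrite subr_eq; apply/eqP.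
apply: diffop_eq => p /=.
rewrite mderivM mderiv_var mxvec_index_eq [j == i]eq_sym [b == a]eq_sym.
by case: (_ && _) => /=; rewrite ?mul1r ?mul0r ?scale1r.
Qed.

Local Notation psi := (@psi F n N).

Lemma com_psi_x X k b : commutator (psi X) (x k b) = \sum_i cst (X i k) * x i b.
Proof.
rewrite com_suml; apply: eq_bigr => i _; rewrite com_suml (bigD1 k) //=.
rewrite com_cstl com_suml (bigD1 b) //= comMl com_xx mul0r add0r com_dx !eqxx mulr1.
rewrite big1 => [|a /negbTE ab]; last first.
  by rewrite comMl com_xx mul0r add0r com_dx [b == a]eq_sym ab andbF mulr0.
rewrite addr0 big1 ?addr0 // => j /negbTE jk.
rewrite com_cstl com_suml big1 ?mulr0 // => a _.
by rewrite comMl com_xx mul0r add0r com_dx eq_sym jk mulr0.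
Qed.

Lemma com_psi_d X k b : commutator (psi X) (d k b) = - \sum_j cst (X k j) * d j b.
Proof.
rewrite com_suml (bigD1 k) //= -sumrN [X in _ + X]big1 ?addr0 => [|i /negbTE ik].
  rewrite com_suml; apply: eq_bigr => j _; rewrite com_cstl com_suml -mulrN; congr (_ * _).
  rewrite (bigD1 b) //= comMl com_dd mulr0 addr0.
  have cxd i a : commutator (x i a) (d k b) = - ((i == k) && (a == b))%:R.
    by rewrite -com_dx /commutator opprB.
  rewrite cxd !eqxx mulN1r big1 ?addr0 // => a /negbTE ab.
  by rewrite comMl com_dd mulr0 addr0 cxd ab andbF oppr0 mul0r.
rewrite com_suml big1 // => j _; rewrite com_cstl com_suml big1 ?mulr0 // => a _.
by rewrite comMl com_dd mulr0 addr0 -[commutator _ _]opprB -/(commutator _ _) com_dx ik oppr0 mul0r.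
Qed.

Let w i j := \sum_a x i a * d j a.

Let cst_sum (I : finType) (f : I -> F) : cst (\sum_i f i) = \sum_i cst (f i) :> Diff.
Proof. exact: (big_morph _ (@cstD F Diff) (@cst0 F Diff)). Qed.

Let com_psi_w X k l :
  commutator (psi X) (w k l) = \sum_i cst (X i k) * w i l - \sum_j cst (X l j) * w k j.
Proof.
rewrite com_sumr (eq_bigr _ (fun a _ => comMr (psi X) (x k a) (d l a))) big_split /=.
congr (_ + _).
  rewrite (eq_bigr (fun a => \sum_i cst (X i k) * x i a * d l a)); last first.
    by move=> a _; rewrite com_psi_x mulr_suml.
  rewrite exchange_big; apply: eq_bigr => i _; rewrite mulr_sumr.
  by apply: eq_bigr => a _; rewrite mulrA.
rewrite (eq_bigr (fun a => - \sum_j cst (X l j) * (x k a * d j a))); last first.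
  move=> a _; rewrite com_psi_d mulrN mulr_sumr; congr (- _).
  by apply: eq_bigr => j _; rewrite mulrA -cstC -mulrA.
by rewrite sumrN exchange_big; congr (- _); apply: eq_bigr => j _; rewrite mulr_sumr.
Qed.

(** The operator psi Y is a combination of the [w k l], on which the commutator with psi X acts as
    on a vector times a covector; the two resulting sums are the matrix products X Y and Y X. *)
Lemma psi_liemap : liemap (@glbr F n) psi.
Proof.
have psi_lin : linmap psi.
  move=> c X Y; rewrite /psi mulr_sumr -big_split /=; apply: eq_bigr => i _.
  rewrite mulr_sumr -big_split /=; apply: eq_bigr => j _.
  by rewrite !mxE cstD cstM mulrDl mulrA.
split=> // X Y; rewrite (linmapD psi_lin) (linmapN psi_lin).
rewrite -/(commutator (psi X) (psi Y)) -[psi Y]/(\sum_k \sum_l cst (Y k l) * w k l).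
rewrite com_sumr.
have -> : \sum_k commutator (psi X) (\sum_l cst (Y k l) * w k l) =
    \sum_k \sum_l cst (Y k l) * (\sum_i cst (X i k) * w i l)
    - \sum_k \sum_l cst (Y k l) * (\sum_j cst (X l j) * w k j).
  rewrite -sumrB; apply: eq_bigr => k _; rewrite com_sumr -sumrB.
  apply: eq_bigr => l _; rewrite comMr -mulrBr -com_psi_w.
  by rewrite [commutator _ (cst _)](_ : _ = 0) ?mul0r ?add0r // /commutator cstC subrr.
congr (_ - _); rewrite /psi.
  rewrite (eq_bigr (fun i => \sum_l \sum_k cst (Y k l) * (cst (X i k) * w i l))).
    rewrite exchange_big /= [RHS]exchange_big; apply: eq_bigr => l _.
    by rewrite exchange_big; apply: eq_bigr => k _; rewrite mulr_sumr.
  move=> i _; apply: eq_bigr => l _; rewrite mxE cst_sum mulr_suml.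
  by apply: eq_bigr => k _; rewrite mulrA -cstM mulrC.
apply: eq_bigr => k _.
have -> : \sum_l cst (Y k l) * (\sum_j cst (X l j) * w k j)
    = \sum_l \sum_j cst (Y k l) * (cst (X l j) * w k j).
  by apply: eq_bigr => l _; rewrite mulr_sumr.
rewrite exchange_big; apply: eq_bigr => j _; rewrite mxE cst_sum mulr_suml.
by apply: eq_bigr => l _; rewrite mulrA -cstM.
Qed.

End DifferentialOperators.

(** * The diagonal embedding and its local nilpotency *)

Section DiagonalEmbedding.
Variables (F : fieldType) (n N : nat).
Local Notation T := (tensor (Diff F n N) (Ugl F n)).
Local Notation iota := (@diagonal F n N).
Local Notation B := (bar iota).
Local Notation E := (Eb iota).

Let lP := tensl_algmap (Diff F n N) (Ugl F n).
Let rP := tensr_algmap (Diff F n N) (Ugl F n).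
Let bP := binj_algmap iota.

Lemma com_algmap (A1 A2 : pzalgType F) (f : A1 -> A2) : algmap f ->
  forall u v, commutator (f u) (f v) = f (commutator u v).
Proof. by move=> fP u v; rewrite /commutator (algmapB fP) !(algmapM fP). Qed.

Let diagonalE X : iota X = tensl _ (psi N X) + tensr _ (uinj X).
Proof. by []. Qed.

Lemma com_diagonal_l X a : commutator (iota X) (tensl _ a) = tensl _ (commutator (psi N X) a).
Proof.
by rewrite diagonalE comDl (com_algmap lP) {2}/commutator tensl_tensr subrr addr0.
Qed.

Lemma com_diagonal_r X b : commutator (iota X) (tensr _ b) = tensr _ (commutator (uinj X) b).
Proof.
by rewrite diagonalE comDl (com_algmap rP) {1}/commutator tensl_tensr subrr add0r.
Qed.

Lemma diagonal_liemap : liemap (@glbr F n) iota.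
Proof.
have [pl pb] := psi_liemap F n N; have [ul ub] := uinj_liemap F n.
split=> [c X Y|X Y].
  rewrite !diagonalE pl ul (algmapD lP) (algmapM lP) (algmap_cst lP).
  by rewrite (algmapD rP) (algmapM rP) (algmap_cst rP) mulrDr addrACA.
rewrite -/(commutator (iota X) (iota Y)) [in RHS](diagonalE Y) comDr.
by rewrite com_diagonal_l com_diagonal_r diagonalE pb ub.
Qed.

Definition bar_x i a : B := binj iota (tensl _ (xvar F i a)).
Definition bar_d i a : B := binj iota (tensl _ (dvar F i a)).

Lemma com_Eb_x a b i al : E a b * bar_x i al - bar_x i al * E a b = bar_x a al *+ (b == i).
Proof.
rewrite -/(commutator (E a b) (bar_x i al)) (com_algmap bP) com_diagonal_l com_psi_x.
rewrite (bigD1 a) //= big1 => [|j /negbTE ja]; last first.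
  by rewrite mxE ja /= cst0 mul0r.
rewrite addr0 mxE eqxx /= eq_sym.
by case: eqP => _; rewrite ?cst1 ?mul1r // cst0 mul0r (algmap0 lP) (algmap0 bP).
Qed.

Lemma com_Eb_d a b i al : E a b * bar_d i al - bar_d i al * E a b = - bar_d b al *+ (i == a).
Proof.
rewrite -/(commutator (E a b) (bar_d i al)) (com_algmap bP) com_diagonal_l com_psi_d.
rewrite (bigD1 b) //= big1 => [|j /negbTE jb]; last first.
  by rewrite mxE jb andbF cst0 mul0r.
rewrite addr0 mxE eqxx andbT (algmapN lP) (algmapN bP) mulNrn; congr (- _).
by case: eqP => _; rewrite ?cst1 ?mul1r // cst0 mul0r (algmap0 lP) (algmap0 bP).
Qed.

Lemma bar_x_comm i a j b : bar_x i a * bar_x j b = bar_x j b * bar_x i a.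
Proof.
apply/eqP; rewrite -subr_eq0 -/(commutator _ _) (com_algmap bP) (com_algmap lP) com_xx.
by rewrite (algmap0 lP) (algmap0 bP).
Qed.

Lemma bar_d_comm i a j b : bar_d i a * bar_d j b = bar_d j b * bar_d i a.
Proof.
apply/eqP; rewrite -subr_eq0 -/(commutator _ _) (com_algmap bP) (com_algmap lP) com_dd.
by rewrite (algmap0 lP) (algmap0 bP).
Qed.

Lemma bar_d_bar_x j b i a : bar_d j b * bar_x i a
  = bar_x i a * bar_d j b + ((i == j) && (a == b))%:R.
Proof.
apply/eqP; rewrite addrC -subr_eq -/(commutator _ _) (com_algmap bP) (com_algmap lP) com_dx.
by rewrite (algmap_nat lP) (algmap_nat bP).
Qed.

Local Notation ad_nilp := (@ad_nilp F n T iota).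

(** Bracketing with a raising root vector strictly lowers the index of x, or gives 0. It raises the
    index of d, and lowers i + (n - j) on the matrix units at (i, j); these are the measures of the
    next two inductions. *)
Let nilp_bx i a : ad_nilp (bar_x i a).
Proof.
have [m] := ubnP (val i); elim: m i => [//|m IH] i; rewrite ltnS => im.
apply: nilp_ad => c d cd; rewrite com_Eb_x.
case: eqP => [di|_]; last by rewrite mulr0n; apply/nilp0/diagonal_liemap.
by rewrite mulr1n; apply: IH; apply: leq_trans im; rewrite -di.
Qed.

Let nilp_bd i a : ad_nilp (bar_d i a).
Proof.
have [m] := ubnP (n - i)%N; elim: m i => [//|m IH] i; rewrite ltnS => im.
apply: nilp_ad => c d cd; rewrite com_Eb_d.
case: eqP => [ic|_]; last by rewrite mulr0n; apply/nilp0/diagonal_liemap.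
rewrite mulr1n; apply: (nilpN diagonal_liemap); apply: IH; apply: leq_trans im.
by rewrite ic; apply: ltn_sub2l => //; apply: ltn_trans cd _.
Qed.

Let nilp_u i j : ad_nilp (binj iota (tensr _ (uinj (delta_mx i j)))).
Proof.
have [ul ub] := uinj_liemap F n.
have [m] := ubnP (i + (n - j))%N; elim: m i j => [//|m IH] i j; rewrite ltnS => im.
apply: nilp_ad => c d cd; rewrite -/(commutator _ _) (com_algmap bP) com_diagonal_r.
rewrite [commutator _ _](_ : _ = uinj (glbr (delta_mx c d) (delta_mx i j))); last by rewrite ub.
rewrite /glbr !mul_delta_mx_cond (linmapD ul) (linmapN ul) (algmapB rP) (algmapB bP).
apply: nilpD; last apply: (nilpN diagonal_liemap).
- case: eqP => [di|_]; last first.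
    rewrite mulr0n (linmap0 ul) (algmap0 rP) (algmap0 bP); exact/nilp0/diagonal_liemap.
  by rewrite mulr1n; apply: IH; apply: leq_trans im; rewrite ltn_add2r -di.
- case: eqP => [jc|_]; last first.
    rewrite mulr0n (linmap0 ul) (algmap0 rP) (algmap0 bP); exact/nilp0/diagonal_liemap.
  rewrite mulr1n; apply: IH; apply: leq_trans im; rewrite ltn_add2l jc.
  by apply: ltn_sub2l => //; apply: ltn_trans cd _.
Qed.

(** Local nilpotency is stable under sums and products, so it is enough to know it for scalars,
    variables, derivatives and matrix units. *)
Lemma nilp_diagonal (t : T) : ad_nilp (binj iota t).
Proof.
have [ul ub] := uinj_liemap F n.
move: t; apply: tensor_ind => [f|u|u v hu hv|u v hu hv].
- suff H (g : {mpoly F[n * N]} -> {mpoly F[n * N]}) : isdiff g ->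
      forall f : Diff F n N, dfun f = g -> ad_nilp (binj iota (tensl _ f)).
    exact: H (dfunP f) _ erefl.
  elim=> [|i|i|a g1 g2 h1 IH1 h2 IH2|g1 g2 h1 IH1 h2 IH2] {}f fE.
  + have -> : f = 1 by apply: diffop_eq => p; rewrite fE.
    rewrite (algmap1 lP) (algmap1 bP) -(cst1 (F := F)).
    exact/nilp_cst/diagonal_liemap.
  + case/mxvec_indexP: i fE => i j fE.
    have -> : f = xvar F i j by apply: diffop_eq => p; rewrite fE.
    exact: nilp_bx.
  + case/mxvec_indexP: i fE => i j fE.
    have -> : f = dvar F i j by apply: diffop_eq => p; rewrite fE.
    exact: nilp_bd.
  + have -> : f = cst a * (DiffOp h1 : Diff F n N) + (DiffOp h2 : Diff F n N).
      by apply: diffop_eq => p; rewrite fE /= scale1r addr0.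
    rewrite (algmapD lP) (algmapD bP) (algmapM lP) (algmapM bP) (algmap_cst lP).
    rewrite (algmap_cst bP); apply: nilpD; last exact: IH2.
    by apply: nilpM; [apply: (nilp_cst diagonal_liemap) | apply: IH1].
  + have -> : f = (DiffOp h1 : Diff F n N) * (DiffOp h2 : Diff F n N).
      by apply: diffop_eq => p; rewrite fE.
    by rewrite (algmapM lP) (algmapM bP); apply: nilpM; [apply: IH1 | apply: IH2].
- move: u; apply: Ugl_ind => [X|a|u hu|u v hu hv|u v hu hv].
  + rewrite (matrix_sum_delta X) (linmap_sum ul) (algmap_sum rP) (algmap_sum bP).
    apply: big_ind => [||i _]; [exact/nilp0/diagonal_liemap | exact: nilpD |].
    rewrite (linmap_sum ul) (algmap_sum rP) (algmap_sum bP).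
    apply: big_ind => [||j _]; [exact/nilp0/diagonal_liemap | exact: nilpD |].
    rewrite (linmapZ ul) (algmapM rP) (algmapM bP) (algmap_cst rP) (algmap_cst bP).
    by apply: nilpM; [apply: (nilp_cst diagonal_liemap) | apply: nilp_u].
  + by rewrite (algmap_cst rP) (algmap_cst bP); apply: (nilp_cst diagonal_liemap).
  + by rewrite (algmapN rP) (algmapN bP); apply: (nilpN diagonal_liemap).
  + by rewrite (algmapD rP) (algmapD bP); apply: nilpD.
  + by rewrite (algmapM rP) (algmapM bP); apply: nilpM.
- by rewrite (algmapD bP); apply: nilpD.
- by rewrite (algmapM bP); apply: nilpM.
Qed.

End DiagonalEmbedding.

(** * Identities between rational functions of the h~_i *)

(** Here u_b stands for 1/(z - t_b) and v_kb for 1/(t_k - t_b): this expands the product of the 1 +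
    1/(z - t_b), which is 1 at infinity and has simple poles at the t_k. The residue argument is
    replaced by an induction on s that uses its hypothesis twice, at z and at the new point t_c in
    place of z. *)
Lemma partial_fractions (R : comPzRingType) (I : eqType) (s : seq I) (t : I -> R)
    (v : I -> I -> R) (z : R) (u : I -> R) : uniq s ->
  (forall k b, k != b -> (t k - t b) * v k b = 1) ->
  (forall k, k \in s -> (z - t k) * u k = 1) ->
  \prod_(b <- s) (1 + u b)
  = 1 + \sum_(k <- s) u k * \prod_(b <- s | b != k) (1 + v k b).
Proof.
move=> us vP; elim: s us z u => [|c s IH] /= us z u uP; first by rewrite !big_nil addr0.
have /andP[cs {}us] := us.
have cne k : k \in s -> c != k by apply: contraTneq => <-.
have vc k : k \in s -> (t c - t k) * v c k = 1 by move=> /cne/vP.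
rewrite !big_cons eqxx /= (IH us z u); last by move=> k ks; apply: uP; rewrite inE ks orbT.
rewrite [X in u c * X](_ : _ = \prod_(b <- s) (1 + v c b)); last first.
  rewrite [LHS]big_seq_cond [RHS]big_seq; apply: eq_bigl => k.
  by case ks: (k \in s) => //=; rewrite eq_sym cne.
rewrite (IH us (t c) (v c) vc) mulrDl mul1r !mulrDr !mulr1 !mulr_sumr.
rewrite -addrA [RHS](_ : _ = 1 + (u c + \sum_(k <- s) u c * (v c k * \prod_(b <- s | b != k) (1 + v k b))
  + \sum_(k <- s) u k * \prod_(b <- c :: s | b != k) (1 + v k b))) //.
congr (1 + _); rewrite [LHS]addrCA -!addrA; congr (u c + _).
rewrite -!big_split /= !big_seq; apply: eq_bigr => k ks.
rewrite big_cons cne //; set A := \prod_(_ <- _ | _) _.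
have uc : (z - t c) * u c = 1 by apply: uP; rewrite mem_head.
have uk : (z - t k) * u k = 1 by apply: uP; rewrite inE ks orbT.
have ck : (t c - t k) * v c k = 1 by apply: vc.
have kc : v k c = - v c k.
  have h : (t k - t c) * v k c = 1 by apply: vP; rewrite eq_sym cne.
  rewrite -[LHS]mulr1 -ck -[RHS]mulr1 -h; ring.
rewrite kc; apply/eqP; rewrite -subr_eq0; apply/eqP.
(* This is u_c u_k = v_ck (u_c - u_k), as an explicit combination of the equations of the three
   inverses. *)
transitivity (- (A * v c k) * (u k * ((z - t c) * u c - 1) - u c * ((z - t k) * u k - 1))
  - A * u c * u k * ((t c - t k) * v c k - 1)); first by ring.
by rewrite uc uk ck !subrr !mulr0 subrr mulr0 subrr.
Qed.

Lemma sum_ord_telescope (V : zmodType) n (f : nat -> V) m : (m <= n)%N ->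
  \sum_(b < n | (b < m)%N) (f b.+1 - f b) = f m - f 0%N.
Proof.
move=> mn; rewrite -(big_ord_widen n (fun b => f b.+1 - f b) mn).
by rewrite -(big_mkord xpredT (fun b => f b.+1 - f b)) telescope_sumr.
Qed.

Lemma sum_ord_telescope_gt (V : zmodType) n (f : nat -> V) m : (m <= n)%N ->
  \sum_(b < n | (m <= b)%N) (f b - f b.+1) = f m - f n.
Proof.
move=> mn; rewrite -(big_mkord (fun b => m <= b)%N (fun b => f b - f b.+1)).
rewrite -(big_nat_widenl _ _ _ (fun _ => true)) //.
rewrite -[RHS]opprB -(telescope_sumr _ mn) -sumrN.
by apply: eq_bigr => b _; rewrite opprB.
Qed.

Section Coefficients.
Variables (F : fieldType) (n : nat).
Local Notation U := (Uhbar F n).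
Local Notation h := (@htd F n).

Definition wt_eps (j : 'I_n) : 'I_n -> int := fun i => (i == j)%:R.

Lemma htdE i j (k : int) :
  h i j + k%:~R = hb F i - hb F j + (k - i%:Z + j%:Z)%:~R.
Proof. by rewrite /htd /ht !intrD mulrNz -!pmulrn -!natr1; ring. Qed.

Lemma htd_invertible i j (k : int) : i != j -> invertible (h i j + k%:~R).
Proof. by move=> ij; rewrite htdE; apply: hb_invertible. Qed.

Lemma htdV i j : i != j -> h i j * rinv (h i j) = 1.
Proof. by move=> /(htd_invertible 0); rewrite addr0 => /rinvP[]. Qed.

Lemma htdBV i j : (h i j - 1) * rinv (h i j - 1) = 1.
Proof.
suff /rinvP[] : invertible (h i j - 1) by [].
have [<-|ij] := eqVneq i j; last exact: (htd_invertible (-1) ij).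
by exists (-1); rewrite /htd subrr add0r mulrNN mulr1.
Qed.

Lemma htdN i j : h i j = - h j i. Proof. by rewrite /htd [RHS]opprB. Qed.

Lemma mul_inj_l (f x y : U) : invertible f -> f * x = f * y -> x = y.
Proof.
by move=> [g [_ gf]] e; rewrite -[x]mul1r -gf -mulrA e mulrA gf mul1r.
Qed.

Lemma rinv_uniq (f g : U) : f * g = 1 -> rinv f = g.
Proof. by move=> fg; apply: rinv_eq => //; rewrite mulrC. Qed.

Lemma htdVN i j : i != j -> rinv (h i j) = - rinv (h j i).
Proof.
move=> ij; apply: rinv_uniq; rewrite htdN mulrNN; apply: htdV.
by rewrite eq_sym.
Qed.

Lemma hshift_rinv w (f : U) : invertible f -> hshift w (rinv f) = rinv (hshift w f).
Proof. by move=> /rinvP[fg _]; apply/esym/rinv_uniq/hshift_inv. Qed.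

Lemma hshift_htd w i j : hshift w (h i j) = h i j + (w i - w j)%:~R.
Proof.
have P := @hshift_algmap F n w.
rewrite /htd /ht !(algmapB P) !(algmap_nat P) !hshift_hb intrD mulrNz; ring.
Qed.

Lemma hshift_htd_fix w i j : w i = w j -> hshift w (h i j) = h i j.
Proof. by move=> e; rewrite hshift_htd e subrr addr0. Qed.

Definition phi_fac (f : U) := f * rinv (f - 1).

Lemma varphiE i : varphi F i = \prod_(k < n | (i < k)%N) phi_fac (h i k).
Proof. by []. Qed.

Lemma hshift_phi_fac w i k : i != k ->
  hshift w (phi_fac (h i k)) = phi_fac (h i k + (w i - w k)%:~R).
Proof.
move=> ik; have P := @hshift_algmap F n w; rewrite /phi_fac (algmapM P) hshift_htd.
rewrite hshift_rinv; last exact: (htd_invertible (-1) ik).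
by rewrite (algmapB P) (algmap1 P) hshift_htd.
Qed.

Lemma hshift_varphi w i :
  hshift w (varphi F i) = \prod_(k < n | (i < k)%N) phi_fac (h i k + (w i - w k)%:~R).
Proof.
rewrite varphiE (algmap_prod (@hshift_algmap F n w)); apply: eq_bigr => k ik.
by rewrite hshift_phi_fac // neq_ltn ik.
Qed.

Lemma hshift_varphi_fix w (i : 'I_n) : (forall k : 'I_n, (i <= k)%N -> w k = w i) ->
  hshift w (varphi F i) = varphi F i.
Proof.
move=> e; rewrite hshift_varphi varphiE; apply: eq_bigr => k ik.
by rewrite e ?(ltnW ik) // (subrr (w i)) addr0.
Qed.

(** Only one factor of varphi_i involves h_j, so a shift supported at j changes that factor alone;
    Phi collects the others. *)
Lemma hshift_varphi_single (i j : 'I_n) : (i < j)%N -> exists Phi,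
  varphi F i = phi_fac (h i j) * Phi /\
  forall w, (forall k, k != j -> w k = 0) ->
    hshift w (varphi F i) = phi_fac (h i j - (w j)%:~R) * Phi.
Proof.
move=> ij; exists (\prod_(k < n | (i < k)%N && (k != j)) phi_fac (h i k)).
split=> [|w w0]; first by rewrite varphiE (bigD1 j).
have wi : w i = 0 by apply: w0; rewrite neq_ltn ij.
rewrite hshift_varphi (bigD1 j ij) /= wi.
have -> : (0 - w j)%:~R = - (w j)%:~R :> U by rewrite (sub0r (w j)) mulrNz.
congr (_ * _); apply: eq_bigr => k /andP[_ kj].
by rewrite (w0 k) // (subrr (0 : int)) addr0.
Qed.

Lemma phi_facP i j (k : int) : i != j ->
  phi_fac (h i j + k%:~R) * (h i j + k%:~R - 1) = h i j + k%:~R.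
Proof.
move=> ij; rewrite /phi_fac -mulrA [rinv _ * _]mulrC.
have /rinvP[-> _] : invertible (h i j + k%:~R - 1); last by rewrite mulr1.
by have := htd_invertible (k - 1) ij; rewrite intrD addrA.
Qed.

(** No factor of varphi_j involves h_i, while the shift by -eps_j turns the factor h/(h - 1) of
    varphi_i, with h = h~_ij, into (h + 1)/h. The quotient of the new factor by the old one is (h^2
    - 1)/h^2, an entry of [Rhat]. *)
Lemma varphi_swap (i j : 'I_n) : (i < j)%N ->
  hshift (fun a => - wt_eps j a) (varphi F i) * varphi F j * h i j ^+ 2
  = hshift (fun a => - wt_eps i a) (varphi F j) * varphi F i * (h i j ^+ 2 - 1).
Proof.
move=> ij; have ij' : i != j by rewrite neq_ltn ij.
have [Phi [e1 e2]] := hshift_varphi_single ij.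
rewrite e2; last by move=> k /negbTE kj; rewrite /wt_eps kj oppr0.
rewrite [hshift _ (varphi F j)]hshift_varphi_fix; last first.
  move=> k jk; have ne (a : 'I_n) : (i < a)%N -> (a == i) = false.
    by move=> ia; rewrite -val_eqE gtn_eqF.
  by rewrite /wt_eps !ne // (leq_trans ij).
rewrite e1 /wt_eps eqxx mulrNz opprK.
have := phi_facP 1 ij'; rewrite addrK => e3.
have := phi_facP 0 ij'; rewrite addr0 => e4.
transitivity (phi_fac (h i j + 1) * h i j * (varphi F j * Phi * h i j)); first by ring.
rewrite e3.
transitivity (varphi F j * Phi * (h i j + 1) * (phi_fac (h i j) * (h i j - 1))); last by ring.
by rewrite e4; ring.
Qed.

End Coefficients.

Section DiagonalCoefficients.
Variables (F : fieldType) (n : nat).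
Local Notation U := (Uhbar F n).
Local Notation h := (@htd F n).

(** The two shifts of the entry add up to eps_i, which replaces h = h~_ji by h - 1. Entry and factor
    become h(h - 2)/(h - 1)^2 and (h - 1)/(h - 2), with product h/(h - 1), the original factor of
    varphi_j. *)
Lemma varphi_cross (i j : 'I_n) : (j < i)%N ->
  hshift (fun a => wt_eps i a - wt_eps j a) 
      (hshift (wt_eps j) ((h j i ^+ 2 - 1) * rinv (h j i ^+ 2)))
    * hshift (wt_eps i) (varphi F j) = varphi F j.
Proof.
move=> ji; have ij : j != i by rewrite neq_ltn ji.
have [Phi [e1 e2]] := hshift_varphi_single F ji.
set w := fun a => _; set c := _ * rinv _.
have hc : c * h j i ^+ 2 = h j i ^+ 2 - 1.
  have := htdV F ij => e; rewrite /c -mulrA [rinv _ * _]mulrC.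
  have /rinvP[-> _] : invertible (h j i ^+ 2); last by rewrite mulr1.
  by rewrite expr2; apply: invertibleM; rewrite -[h j i]addr0; apply: (htd_invertible _ 0 ij).
have shh : hshift w (hshift (wt_eps j) (h j i)) = h j i - 1.
  have P := @hshift_algmap F n w.
  rewrite hshift_htd (algmapD P) (algmap_int P) hshift_htd -addrA -intrD; congr (_ + _).
  by rewrite /w /wt_eps !eqxx [i == j]eq_sym (negbTE ij).
have hc' : hshift w (hshift (wt_eps j) c) * (h j i - 1) ^+ 2 = (h j i - 1) ^+ 2 - 1.
  have SP := algmap_comp (@hshift_algmap F n (wt_eps j)) (@hshift_algmap F n w).
  have e : (hshift w \o hshift (wt_eps j)) (h j i ^+ 2) = (h j i - 1) ^+ 2.
    by rewrite expr2 (algmapM SP) /= shh -expr2.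
  have := congr1 (hshift w \o hshift (wt_eps j)) hc.
  by rewrite (algmapM SP) (algmapB SP) (algmap1 SP) e.
rewrite e2; last by move=> k /negbTE ki; rewrite /wt_eps ki.
rewrite e1 /wt_eps eqxx mulrA; congr (_ * Phi).
have e3 := phi_facP F (-1) ij; have := phi_facP F 0 ij; rewrite addr0 => e4.
have inv : invertible ((h j i - 1) ^+ 2).
  by rewrite expr2; apply: invertibleM; apply: (htd_invertible F (-1) ij).
apply: (mul_inj_l inv).
transitivity (hshift w (hshift (wt_eps j) c) * (h j i - 1) ^+ 2 * phi_fac (h j i - 1)).
  by rewrite mulrCA mulrA.
rewrite hc'.
transitivity (h j i * (phi_fac (h j i - 1) * (h j i - 1 - 1))); first by ring.
rewrite e3.
transitivity ((h j i - 1) * (phi_fac (h j i) * (h j i - 1))); last by ring.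
by rewrite e4; ring.
Qed.

Lemma phi_fac0 : phi_fac (0 : U) = 0. Proof. exact: mul0r. Qed.

Lemma htdxx i : h i i = 0. Proof. exact: subrr. Qed.

Lemma phi_facE i b : phi_fac (h i b) = 1 + rinv (h i b - 1).
Proof.
by rewrite /phi_fac -{1}[h i b](subrK 1) mulrDl htdBV mul1r.
Qed.

Lemma phi_facDE k b : k != b -> phi_fac (h k b + 1) = 1 + rinv (h k b).
Proof. by move=> kb; rewrite /phi_fac addrK mulrDl htdV // mul1r. Qed.

(** The factor b = i is [phi_fac 0], that is 0. Hence the value is 0 for m <= i, varphi_i at m = i +
    1, and 1 at m = n. *)
Definition upper_prod (i : 'I_n) (m : nat) : U :=
  \prod_(b < n | (m <= b)%N) phi_fac (h i b).

Lemma upper_prodS (i a : 'I_n) : upper_prod i a = phi_fac (h i a) * upper_prod i a.+1.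
Proof.
rewrite /upper_prod (bigD1 a) //=; congr (_ * _); apply: eq_bigl => b.
by rewrite andbC eq_sym -ltn_neqAle.
Qed.

Lemma upper_prod0 (i : 'I_n) m : (m <= i)%N -> upper_prod i m = 0.
Proof. by move=> mi; rewrite /upper_prod (bigD1 i) //= htdxx phi_fac0 mul0r. Qed.

Lemma upper_prod_n (i : 'I_n) : upper_prod i n = 1.
Proof. by rewrite /upper_prod big_pred0 // => b; rewrite leqNgt ltn_ord. Qed.

Lemma varphi_inv (i : 'I_n) : varphi F i * rinv (varphi F i) = 1.
Proof.
suff /rinvP[] : invertible (varphi F i) by [].
apply: (big_ind (@invertible U)) => [||k ik]; first by exists 1; rewrite mulr1.
  by move=> x y; apply: invertibleM.
have ik' : i != k by rewrite neq_ltn ik.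
apply: invertibleM; first by rewrite -[htd _ _ _]addr0; apply: (htd_invertible F 0).
by exists (h i k - 1); rewrite mulrC htdBV.
Qed.

(* A left eigenvector of the matrix diag(h~) minus the strictly upper triangular
   matrix of ones, which describes the pairing of the chain of d with x; its
   partial sums are given by upper_prod. *)
Definition upper_eigen (i a : 'I_n) : U :=
  (upper_prod i a.+1 - upper_prod i a) * rinv (varphi F i).

Lemma upper_eigenP (i a : 'I_n) :
  upper_eigen i a * h i a + \sum_(b < n | (b < a)%N) upper_eigen i b = 0.
Proof.
rewrite -mulr_suml (sum_ord_telescope (upper_prod i) (ltnW (ltn_ord a))).
rewrite (upper_prod0 (leq0n i)) subr0 /upper_eigen.
set q := rinv _; set T1 := upper_prod i a.+1.
have e : (T1 - upper_prod i a) * h i a + upper_prod i a = 0.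
  have [->|ia] := eqVneq i a; first by rewrite htdxx mulr0 add0r upper_prod0.
  have := phi_facP F 0 ia; rewrite addr0 => e4; rewrite upper_prodS -/T1.
  transitivity (T1 * (h i a - phi_fac (h i a) * (h i a - 1))); first by ring.
  by rewrite e4; ring.
transitivity (((T1 - upper_prod i a) * h i a + upper_prod i a) * q); first by ring.
by rewrite e mul0r.
Qed.

Lemma upper_eigen_diag i : upper_eigen i i = 1.
Proof. by rewrite /upper_eigen [upper_prod i i]upper_prod0 // subr0 varphi_inv. Qed.

Lemma upper_eigen_lt (i a : 'I_n) : (a < i)%N -> upper_eigen i a = 0.
Proof. by move=> ai; rewrite /upper_eigen !upper_prod0 ?subrr ?mul0r // ltnW. Qed.

Lemma upper_eigen_varphi (i a : 'I_n) :
  upper_eigen i a * varphi F i = upper_prod i a.+1 - upper_prod i a.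
Proof. by rewrite /upper_eigen -mulrA [rinv _ * _]mulrC varphi_inv mulr1. Qed.

(** Cut off to 0 beyond k, where the empty product would be 1, so that the telescoping sums have no
    contribution from the upper end. *)
Definition lower_prod (k : 'I_n) (m : nat) : U :=
  if (m <= k)%N then \prod_(b < n | (m <= b)%N && (b < k)%N) (1 + rinv (h k b)) else 0.

Lemma lower_prodS (k a : 'I_n) : (a < k)%N ->
  lower_prod k a = (1 + rinv (h k a)) * lower_prod k a.+1.
Proof.
move=> ak; rewrite /lower_prod (ltnW ak) ak (bigD1 a) /= ?leqnn //.
congr (_ * _); apply: eq_bigl => b.
by rewrite andbAC [(_ <= _)%N && _]andbC eq_sym -ltn_neqAle.
Qed.

Lemma lower_prod_diag (k : 'I_n) : lower_prod k k = 1.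
Proof.
rewrite /lower_prod leqnn big_pred0 // => b.
by case: leqP => //= kb; rewrite ltnNge kb.
Qed.

Lemma lower_prod_gt (k : 'I_n) m : (k < m)%N -> lower_prod k m = 0.
Proof. by move=> km; rewrite /lower_prod leqNgt km. Qed.

(* Likewise for diag(h~) plus the strictly lower triangular matrix of ones and
   the pairing of the chain of x with d. *)
Definition lower_eigen (k a : 'I_n) : U := lower_prod k a - lower_prod k a.+1.

Lemma lower_eigenP (k a : 'I_n) :
  lower_eigen k a * h a k + \sum_(b < n | (a < b)%N) lower_eigen k b = 0.
Proof.
rewrite (sum_ord_telescope_gt (lower_prod k) (ltn_ord a)).
rewrite (lower_prod_gt (ltn_ord k)) subr0 /lower_eigen.
case: (ltngtP a k) => [ak|ka|/val_inj->].
- have ka : k != a by rewrite neq_ltn ak orbT.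
  rewrite lower_prodS //; set t := lower_prod k a.+1.
  transitivity (t * (1 - h k a * rinv (h k a))); first by rewrite [h a k]htdN; ring.
  by rewrite htdV // subrr mulr0.
- by rewrite !lower_prod_gt // ?ltnS ?(ltnW ka) // subrr mul0r addr0.
- by rewrite htdxx mulr0 add0r lower_prod_gt.
Qed.

Lemma lower_eigen_diag k : lower_eigen k k = 1.
Proof. by rewrite /lower_eigen lower_prod_diag lower_prod_gt // subr0. Qed.

Lemma lower_eigen_gt (k a : 'I_n) : (k < a)%N -> lower_eigen k a = 0.
Proof. by move=> ka; rewrite /lower_eigen !lower_prod_gt ?subrr // ltnS ltnW. Qed.

(** The shift by eps_k turns the factors h/(h - 1) of varphi_k, which belong to b > k, into 1 + 1/h.
    They then match the factors b < k of [lower_prod], and together form the product over b != k of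
    a partial fraction expansion. *)
Lemma hshift_varphi_lower (k : 'I_n) m : (m <= k)%N ->
  hshift (wt_eps k) (varphi F k) * lower_prod k m
  = \prod_(b < n | (m <= b)%N && (b != k)) (1 + rinv (h k b)).
Proof.
move=> mk; rewrite hshift_varphi /lower_prod mk [RHS](bigID (fun b : 'I_n => (k < b)%N)) /=.
congr (_ * _).
  apply: congr_big => // [b|b kb].
    by case: ltnP => kb; rewrite ?andbF // (leq_trans mk (ltnW kb)) -val_eqE gtn_eqF.
  have kb' : k != b by rewrite neq_ltn kb.
  rewrite -phi_facDE //; congr (phi_fac (_ + _)).
  by rewrite /wt_eps eqxx [b == k]eq_sym (negbTE kb').
apply: eq_bigl => b; rewrite -andbA; congr (_ && _).
by rewrite -leqNgt [RHS]andbC ltn_neqAle andbC.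
Qed.

(** The expansion at z = h~_i with poles t_k = h~_k + 1 for k >= m, so that 1 + u_b is h/(h - 1)
    with h = h~_ib. The index k = i is admissible because z - t_i = -1, and k < m contributes 0 by
    the cut-off of [lower_prod]. *)
Lemma partial_fractions_htd (i : 'I_n) m :
  \sum_k rinv (h k i + 1) * (hshift (wt_eps k) (varphi F k) * lower_prod k m)
  = 1 - upper_prod i m.
Proof.
set s := [seq b : 'I_n <- index_enum 'I_n | (m <= b)%N].
have us : uniq s by rewrite filter_uniq // index_enum_uniq.
have vP (k b : 'I_n) : k != b -> (ht F k + 1 - (ht F b + 1)) * rinv (h k b) = 1.
  by move=> kb; rewrite opprD addrACA subrr addr0; apply: htdV.
have uP (k : 'I_n) : k \in s -> (ht F i - (ht F k + 1)) * rinv (h i k - 1) = 1.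
  by move=> _; rewrite opprD addrA; apply: htdBV.
have := partial_fractions us vP uP.
rewrite !big_filter (eq_bigr (fun b => phi_fac (h i b))) -/(upper_prod i m); last first.
  by move=> b _; rewrite phi_facE.
move=> ->; rewrite opprD addrA subrr sub0r -sumrN [RHS]big_mkcond /=.
apply: eq_bigr => k _; case: ifP => mk; last first.
  by rewrite lower_prod_gt ?mulr0 // ltnNge mk.
rewrite hshift_varphi_lower // big_filter_cond -mulNr; congr (_ * _).
apply: rinv_uniq; rewrite mulrN -mulNr opprD.
by rewrite -htdN -/(h i k - 1) htdBV.
Qed.

End DiagonalCoefficients.

(** * Projected vectors for the x and for the d *)

Section Projections.
Variables (F : fieldType) (n N : nat).
Local Notation U := (Uhbar F n).
Local Notation iota := (@diagonal F n N).
Local Notation B := (bar iota).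
Local Notation O := (of_Uhbar iota).
Local Notation E := (Eb iota).
Local Notation J := (in_bar_nplus (iota := iota)).
Local Notation cls := (cls (iota := iota)).
Local Notation h := (@htd F n).
Local Notation x := (@bar_x F n N).
Local Notation d := (@bar_d F n N).

Let iotaP := diagonal_liemap F n N.
Let OP := O_algmap iotaP.

(** With indices from 0, h~_i is h_i - (i + 1), so adding n + 1 gives h_i + n - i. In [kappa_d] the
    constant n - i is already contained in -h~ at the reversed index. The value 0 for m >= n is a
    default. *)
Definition kappa_x (m : nat) : U :=
  if insub m is Some i then ht F (i : 'I_n) + n.+1%:R else 0.
Definition kappa_d (m : nat) : U :=
  if insub m is Some i then - ht F (rev_ord (i : 'I_n)) else 0.

Let kapxE (i : 'I_n) : kappa_x i = ht F i + n.+1%:R.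
Proof. by rewrite /kappa_x valK. Qed.
Let kapdE (i : 'I_n) : kappa_d i = - ht F (rev_ord i).
Proof. by rewrite /kappa_d valK. Qed.

Let kapxB (i j : 'I_n) : kappa_x i - kappa_x j = h i j.
Proof. by rewrite !kapxE /htd opprD addrACA subrr addr0. Qed.

Let kapdB (i j : 'I_n) : kappa_d i - kappa_d j = h (rev_ord j) (rev_ord i).
Proof. by rewrite !kapdE /htd opprK addrC. Qed.

Let O_ht (j : 'I_n) : O (ht F j) = E j j - (j.+1)%:R.
Proof. by rewrite (algmapB OP) (algmap_nat OP) O_hb. Qed.

(** Left multiplication by x is the pairing of the same type, by d that of the opposite type, whose
    eigenvector is [lower_eigen]. *)
Lemma projection_x (b : 'I_N) : exists Y : 'I_n -> B,
  [/\ forall i k j : 'I_n, (i < k)%N -> J (E i k * Y j),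
      forall j, cls (x j b) = cls (Y j),
      forall j, wt (wt_eps j) (Y j),
      forall a,
        (forall i j : 'I_n, (j <= i)%N -> cls (x i a * Y j) = cls (x i a * x j b)) /\
        (forall (i j : 'I_n) q, (i < j)%N -> h i j * q = 1 ->
           cls (x i a * Y j) = cls (x i a * x j b + x j a * x i b * O q))
    & forall a,
        (forall i j, i != j -> cls (d i a * Y j) = cls (d i a * x j b)) /\
        (forall j, cls (d j a * Y j) = cls (\sum_k d k a * x k b * O (lower_eigen F j k)))].
Proof.
have e_diag (j : 'I_n) : O (kappa_x j) = E j j + (n - j)%:R.
  rewrite kapxE (algmapD OP) O_ht (algmap_nat OP) -subSS natrB; last exact/leqW/ltn_ord.
  by rewrite addrAC -addrA.
have kinv (i j : 'I_n) : i != j -> invertible (kappa_x i - kappa_x j).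
  by move=> ij; rewrite kapxB -[htd _ _ _]addr0; apply: (htd_invertible F 0).
have e_plus (i k : 'I_n) : (i < k)%N -> J (E i k).
  by move=> ik; rewrite -[E i k]mul1r; apply: nplus_Eb.
have e_minus (i k : 'I_n) u : (k < i)%N -> in_nminus_bar (E i k * u).
  by move=> ik; apply: nminus_Eb.
have cov i k j : E i k * x j b - x j b * E i k = x i b *+ (k == j) by apply: com_Eb_x.
have [Y [Y1 Y2 Y3 Y4 Y5]] :=
  hw_vector iotaP (Eb_comm iotaP) e_diag e_plus e_minus kinv cov.
exists Y; split=> // [j i|a|a].
- rewrite Y3 /wt_eps mulrDr; congr (_ + _).
  by case: eqP => [->|_]; rewrite ?mulr1n ?mulr1 ?mulr0n ?mulr0.
- have [i k l|h1 h2] := Y4 (x^~ a).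
    by rewrite -opprB com_Eb_x mulNrn eq_sym.
  by split=> // i j q ij hq; apply: h2 => //; rewrite kapxB.
- have [i k l|h1 h2] := Y5 (d^~ a).
    by rewrite -opprB com_Eb_d mulNrn opprK.
  split=> // j; apply: h2 => [k||k]; [|exact: lower_eigen_diag|exact: lower_eigen_gt].
  by rewrite kapxB; apply: lower_eigenP.
Qed.

Let ltn_rev (i j : 'I_n) : (rev_ord i < rev_ord j)%N = (j < i)%N.
Proof. by rewrite /= ltn_sub2lE ?ltnS. Qed.

(** The automorphism reverses the indices, so the inequalities change direction and [upper_eigen]
    replaces [lower_eigen]; now d is of the same type and x of the opposite one. *)
Lemma projection_d (b : 'I_N) : exists Y : 'I_n -> B,
  [/\ forall i k j : 'I_n, (i < k)%N -> J (E i k * Y j),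
      forall j, cls (d j b) = cls (Y j),
      forall j, wt (fun i => - wt_eps j i) (Y j),
      forall a,
        (forall i j : 'I_n, (i <= j)%N -> cls (d i a * Y j) = cls (d i a * d j b)) /\
        (forall (i j : 'I_n) q, (j < i)%N -> h j i * q = 1 ->
           cls (d i a * Y j) = cls (d i a * d j b + d j a * d i b * O q))
    & forall a,
        (forall i j, i != j -> cls (x i a * Y j) = cls (x i a * d j b)) /\
        (forall j, cls (x j a * Y j) = cls (\sum_k x k a * d k b * O (upper_eigen F j k)))].
Proof.
pose e i k : B := - E (rev_ord k) (rev_ord i).
have e_comm i k j l : e i k * e j l - e j l * e i k = e i l *+ (k == j) - e j k *+ (l == i).
  rewrite !mulrNN (Eb_comm iotaP) !(inj_eq rev_ord_inj) !mulNrn opprK addrC.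
  by rewrite [j == k]eq_sym [i == l]eq_sym.
have e_diag (j : 'I_n) : O (kappa_d j) = e j j + (n - j)%:R.
  by rewrite kapdE (algmapN OP) O_ht opprB addrC /= subnSK.
have kinv (i j : 'I_n) : i != j -> invertible (kappa_d i - kappa_d j).
  move=> ij; rewrite kapdB -[htd _ _ _]addr0; apply: (htd_invertible F 0).
  by rewrite (inj_eq rev_ord_inj) eq_sym.
have e_plus (i k : 'I_n) : (i < k)%N -> J (e i k).
  by move=> ik; rewrite -[e i k]mul1r mulrN -mulNr; apply: nplus_Eb; rewrite ltn_rev.
have e_minus (i k : 'I_n) u : (k < i)%N -> in_nminus_bar (e i k * u).
  by move=> ik; rewrite mulNr -mulrN; apply: nminus_Eb; rewrite ltn_rev.
have cov i k j : e i k * d (rev_ord j) b - d (rev_ord j) b * e i k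
    = d (rev_ord i) b *+ (k == j).
  rewrite mulNr mulrN -opprD com_Eb_d mulNrn opprK (inj_eq rev_ord_inj).
  by rewrite eq_sym.
have [Y [Y1 Y2 Y3 Y4 Y5]] := hw_vector iotaP e_comm e_diag e_plus e_minus kinv cov.
exists (fun j => Y (rev_ord j)); split=> [i k j ik|j|j i|a|a].
- have := Y1 (rev_ord k) (rev_ord i) (rev_ord j).
  by rewrite ltn_rev /e !rev_ordK mulNr => /(_ ik)/nplusN; rewrite opprK.
- by rewrite -Y2 rev_ordK.
- have := Y3 (rev_ord i) (rev_ord j); rewrite /e !rev_ordK mulNr mulrN => /eqP.
  rewrite eqr_oppLR opprD opprK => /eqP ->; rewrite mulrDr; congr (_ + _).
  rewrite (inj_eq rev_ord_inj) /wt_eps.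
  by case: eqP => [->|_]; rewrite ?mulr1n ?mulrN1z ?mulrN1 ?mulr0n ?oppr0 ?mulr0.
- have [i k l|h1 h2] := Y4 (fun i => d (rev_ord i) a).
    by rewrite mulrN mulNr opprK addrC com_Eb_d (inj_eq rev_ord_inj).
  split=> [i j ij|i j q ji hq].
    have := h1 (rev_ord i) (rev_ord j); rewrite !rev_ordK; apply.
    by rewrite leqNgt ltn_rev -leqNgt.
  have := h2 (rev_ord i) (rev_ord j) q; rewrite ltn_rev kapdB !rev_ordK.
  exact.
- have [i k l|h1 h2] := Y5 (fun i => x (rev_ord i) a).
    by rewrite mulrN mulNr opprK addrC com_Eb_x (inj_eq rev_ord_inj) eq_sym.
  split=> [i j ij|j].
    have := h1 (rev_ord i) (rev_ord j); rewrite !rev_ordK (inj_eq rev_ord_inj).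
    exact.
  have := h2 (rev_ord j) (fun k => upper_eigen F j (rev_ord k)); rewrite rev_ordK => -> //.
  + congr cls; rewrite [RHS](reindex_inj rev_ord_inj).
    by apply: eq_bigr => k _; rewrite ?rev_ordK.
  + move=> k; rewrite kapdB rev_ordK -[RHS](upper_eigenP F j (rev_ord k)); congr (_ + _).
    rewrite [RHS](reindex_inj rev_ord_inj).
    by apply: eq_bigl => l; rewrite ltn_rev.
  + exact: upper_eigen_diag.
  + by move=> k; rewrite -ltn_rev rev_ordK => /upper_eigen_lt ->.
Qed.

End Projections.

(** * The three reordering relations *)

Lemma sum_entry (V : nmodType) (I : finType) (f : I -> I -> V) (p : I * I) :
  (forall k l, (k, l) != p -> f k l = 0) ->
  \sum_k \sum_l f k l = f p.1 p.2.
Proof.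
move=> f0; rewrite pair_big /= (bigD1 p) //= big1 ?addr0 // => -[k l] kl.
exact: f0.
Qed.

Lemma sum_two_entries (V : nmodType) (I : finType) (f : I -> I -> V) (p q : I * I) :
  p != q -> (forall k l, (k, l) != p -> (k, l) != q -> f k l = 0) ->
  \sum_k \sum_l f k l = f p.1 p.2 + f q.1 q.2.
Proof.
move=> pq f0; rewrite pair_big /= (bigD1 p) //= (bigD1 q) 1?eq_sym //= big1 ?addr0 //.
by move=> -[k l] /andP[kp kq]; apply: f0.
Qed.

Lemma hshift_id (F : fieldType) n (w : 'I_n -> int) (f : Uhbar F n) :
  (forall i, w i = 0) -> hshift w f = f.
Proof.
move=> w0; have P := @hshift_algmap F n w; move: f.
apply: Uhbar_ind => [i|a|u v hu hv|u v hu hv|u v uv hu].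
- by rewrite hshift_hb w0 addr0.
- by rewrite (algmap_cst P).
- by rewrite (algmapD P) hu hv.
- by rewrite (algmapM P) hu hv.
- rewrite -[LHS]mul1r -uv [u * v]mulrC -mulrA -{1}hu -(algmapM P) uv (algmap1 P).
  by rewrite mulr1.
Qed.

Section Relations.
Variables (F : fieldType) (n N : nat) (P : fseries F n).
Hypothesis P_extremal : extremal_projector P.
Local Notation U := (Uhbar F n).
Local Notation iota := (@diagonal F n N).
Local Notation B := (bar iota).
Local Notation O := (of_Uhbar iota).
Local Notation cls := (cls (iota := iota)).
Local Notation h := (@htd F n).
Local Notation x := (@bar_x F n N).
Local Notation d := (@bar_d F n N).
Local Notation dia := (@diamond F n _ iota P).
Local Notation dbar := (@dhdbar F n N).
Local Notation phi := (@varphi F n).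

Let iotaP := diagonal_liemap F n N.
Let OP := O_algmap iotaP.

Let dhxE i a : dhx F i a = cls (x i a).
Proof. by []. Qed.

Let dbarE j b : dbar j b = cls (d j b * O (phi j)).
Proof. exact: ract_cls. Qed.

Let diaE (u v y : B) : (forall i j : 'I_n, (i < j)%N -> in_bar_nplus (Eb iota i j * y)) ->
  cls v = cls y -> dia (cls u) (cls v) = cls (u * y).
Proof.
move=> hy /cls_eqP vy.
exact: (diamond_cls iotaP (@nilp_diagonal F n N) P_extremal).
Qed.

Let diaOE (u v y : B) f : (forall i j : 'I_n, (i < j)%N -> in_bar_nplus (Eb iota i j * y)) ->
  cls v = cls y -> dia (cls u) (cls (v * O f)) = cls (u * y * O f).
Proof.
move=> hy vy; rewrite -mulrA; apply: diaE; last exact: cls_O.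
by move=> i j ij; rewrite mulrA; apply: nplus_O (hy _ _ ij).
Qed.

Lemma dia_xx_ge (i j : 'I_n) a b : (j <= i)%N ->
  dia (dhx F i a) (dhx F j b) = cls (x i a * x j b).
Proof.
move=> ji; have [Y [Y1 Y2 _ Y4 _]] := projection_x F n b.
by rewrite !dhxE (diaE _ (fun i k => Y1 i k j) (Y2 j)); have [-> ] := Y4 a.
Qed.

Lemma dia_xx_lt (i j : 'I_n) a b : (i < j)%N ->
  dia (dhx F i a) (dhx F j b) = cls (x i a * x j b + x j a * x i b * O (rinv (h i j))).
Proof.
move=> ij; have [Y [Y1 Y2 _ Y4 _]] := projection_x F n b.
rewrite !dhxE (diaE _ (fun i k => Y1 i k j) (Y2 j)).
by have [_] := Y4 a; apply=> //; apply: htdV; rewrite neq_ltn ij.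
Qed.

(* The coefficient produced by the two factors varphi in a product of two
   dual variables. *)
Definition dual_coeff (i j : 'I_n) : U := hshift (fun k => - wt_eps j k) (phi i) * phi j.

(** The factor varphi_i of the left operand crosses the highest weight vector, of weight -eps_j, on
    its way to the right; this is the shift in [dual_coeff]. *)
Lemma dia_dd_le (i j : 'I_n) a b : (i <= j)%N ->
  dia (dbar i a) (dbar j b) = cls (d i a * d j b * O (dual_coeff i j)).
Proof.
move=> ij; have [Y [Y1 Y2 Y3 Y4 _]] := projection_d F n b.
rewrite !dbarE (diaOE _ _ (fun i k => Y1 i k j) (Y2 j)) -[_ * _ * Y j]mulrA.
rewrite (wt_O iotaP _ (Y3 j)).
rewrite mulrA -mulrA -(algmapM OP); apply: (cls_O iotaP).
by have [->] := Y4 a.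
Qed.

Lemma dia_dd_gt (i j : 'I_n) a b : (j < i)%N -> dia (dbar i a) (dbar j b)
  = cls ((d i a * d j b + d j a * d i b * O (rinv (h j i))) * O (dual_coeff i j)).
Proof.
move=> ji; have [Y [Y1 Y2 Y3 Y4 _]] := projection_d F n b.
rewrite !dbarE (diaOE _ _ (fun i k => Y1 i k j) (Y2 j)) -[_ * _ * Y j]mulrA.
rewrite (wt_O iotaP _ (Y3 j)).
rewrite mulrA -mulrA -(algmapM OP); apply: (cls_O iotaP).
by have [_] := Y4 a; apply=> //; apply: htdV; rewrite neq_ltn ji.
Qed.

Lemma dia_xd_ne (i j : 'I_n) a b : i != j ->
  dia (dhx F i a) (dbar j b) = cls (x i a * d j b * O (phi j)).
Proof.
move=> ij; have [Y [Y1 Y2 Y3 _ Y5]] := projection_d F n b.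
rewrite dhxE dbarE (diaOE _ _ (fun i k => Y1 i k j) (Y2 j)); apply: (cls_O iotaP).
by have [->] := Y5 a.
Qed.

Lemma dia_xd_eq (j : 'I_n) a b : dia (dhx F j a) (dbar j b)
  = cls (\sum_k x k a * d k b * O (upper_eigen F j k * phi j)).
Proof.
have [Y [Y1 Y2 Y3 _ Y5]] := projection_d F n b.
rewrite dhxE dbarE (diaOE _ _ (fun i k => Y1 i k j) (Y2 j)).
have [_ e] := Y5 a; rewrite (cls_O iotaP _ (e j)) mulr_suml; congr cls.
by apply: eq_bigr => k _; rewrite -mulrA -(algmapM OP).
Qed.

Lemma dia_dx_ne (k l : 'I_n) a b : k != l ->
  dia (dbar k b) (dhx F l a) = cls (d k b * x l a * O (hshift (wt_eps l) (phi k))).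
Proof.
move=> kl; have [Y [Y1 Y2 Y3 _ Y5]] := projection_x F n a.
rewrite dhxE dbarE (diaE _ (fun i k => Y1 i k l) (Y2 l)) -mulrA (wt_O iotaP _ (Y3 l)).
rewrite mulrA; apply: (cls_O iotaP).
by have [->] := Y5 b.
Qed.

Lemma dia_dx_eq (k : 'I_n) a b : dia (dbar k b) (dhx F k a)
  = cls (\sum_m d m b * x m a * O (lower_eigen F k m * hshift (wt_eps k) (phi k))).
Proof.
have [Y [Y1 Y2 Y3 _ Y5]] := projection_x F n a.
rewrite dhxE dbarE (diaE _ (fun i j => Y1 i j k) (Y2 k)) -mulrA (wt_O iotaP _ (Y3 k)).
have [_ e] := Y5 b; rewrite mulrA (cls_O iotaP _ (e k)) mulr_suml; congr cls.
by apply: eq_bigr => m _; rewrite -mulrA -(algmapM OP).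
Qed.

Let lact0 z : lact (0 : U) z = 0 :> red iota.
Proof. by rewrite -(rprK z) (lact_cls iotaP) (algmap0 OP) mul0r; exact: raddf0. Qed.

Let lact1 z : lact (1 : U) z = z :> red iota.
Proof. by rewrite -[in LHS](rprK z) (lact_cls iotaP) (algmap1 OP) mul1r rprK. Qed.

Let lact_wt w (u : B) f : wt w u -> lact f (cls u) = cls (u * O (hshift w f)).
Proof. by move=> wu; rewrite (lact_cls iotaP) (wt_O iotaP _ wu). Qed.

Let wt_x i a : wt (wt_eps i) (x i a).
Proof.
move=> k; apply/eqP; rewrite mulrDr -subr_eq0 opprD addrA com_Eb_x subr_eq0.
by apply/eqP; rewrite /wt_eps; case: eqP => [->|_]; rewrite ?mulr1n ?mulr1 ?mulr0n ?mulr0.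
Qed.

Let wt_d i a : wt (fun k => - wt_eps i k) (d i a).
Proof.
move=> k; apply/eqP; rewrite mulrDr -subr_eq0 opprD addrA com_Eb_d subr_eq0.
apply/eqP; rewrite /wt_eps [i == k]eq_sym.
by case: eqP => [->|_]; rewrite ?mulr1n ?mulrN1z ?mulrN1 ?mulr0n ?oppr0 ?mulr0.
Qed.

Lemma Rhat_diag (i : 'I_n) : Rhat F i i i i = 1.
Proof. by rewrite /Rhat !eqxx ltnn. Qed.

Lemma Rhat_direct (i j : 'I_n) : i != j -> Rhat F i j i j = rinv (h i j).
Proof. by move=> ij; rewrite /Rhat !eqxx ij. Qed.

Lemma Rhat_swap (i j : 'I_n) : i != j -> Rhat F i j j i
  = if (i < j)%N then (h i j ^+ 2 - 1) * rinv (h i j ^+ 2) else 1.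
Proof. by move=> ij; rewrite /Rhat !eqxx eq_sym (negbTE ij). Qed.

Lemma Rhat0 (i j k l : 'I_n) :
  (k, l) != (i, j) -> (k, l) != (j, i) -> Rhat F i j k l = 0.
Proof.
rewrite !xpair_eqE /Rhat => /negbTE kl1 /negbTE kl2.
by rewrite andbA kl1 /= kl2.
Qed.


Let wt_ext w w' (u : B) : w =1 w' -> wt w u -> wt w' u.
Proof. by move=> e wu k; rewrite wu e. Qed.

Let O_sum (u : B) f g : u * O f + u * O g = u * O (f + g).
Proof. by rewrite -mulrDr -(algmapD OP). Qed.

Let O_prod (u : B) f g : u * O f * O g = u * O (f * g).
Proof. by rewrite -mulrA -(algmapM OP). Qed.

Let rinv_sq (i j : 'I_n) : i != j -> rinv (h i j ^+ 2) = rinv (h i j) ^+ 2.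
Proof.
move=> ij; apply: rinv_uniq; have := htdV F ij => e.
by rewrite !expr2 mulrACA e mulr1.
Qed.

(** The weight of x_i x_j, and likewise of d_i d_j, has equal coordinates at i and j, so the entries
    of [Rhat] pass through these products unshifted. *)
Let hshift_Rhat w (i j : 'I_n) : i != j -> w i = w j ->
  let q := rinv (h i j) in
  hshift w q = q /\ hshift w ((h i j ^+ 2 - 1) * rinv (h i j ^+ 2)) = 1 - q * q.
Proof.
move=> ij wij; have SP := @hshift_algmap F n w.
have inv : invertible (h i j) by rewrite -[htd _ _ _]addr0; apply: (htd_invertible F 0).
have sq : hshift w (rinv (h i j)) = rinv (h i j) by rewrite hshift_rinv // hshift_htd_fix.
split=> //; set q := rinv (h i j) in sq *; have hq : h i j * q = 1 by apply: htdV.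
rewrite rinv_sq // (algmapM SP) (algmapB SP) !expr2 !(algmapM SP) (algmap1 SP) sq.
rewrite hshift_htd_fix //.
transitivity ((h i j * q) * (h i j * q) - q * q); first by rewrite /q; ring.
by rewrite hq mulr1.
Qed.

(** For i < j the entry 1 - q^2 compensates the q^2 that arises from q times the correction in
    [dia_xx_lt]; for i > j this correction cancels the direct entry q. *)
Lemma relation_xx (i j : 'I_n) a b : dia (dhx F i a) (dhx F j b) =
  \sum_(k < n) \sum_(l < n) lact (Rhat F i j k l) (dia (dhx F k b) (dhx F l a)).
Proof.
have [<-|ij] := eqVneq i j.
  rewrite (sum_entry (p := (i, i))) /= => [|k l kl]; last first.
    by rewrite Rhat0.
  by rewrite Rhat_diag lact1 !dia_xx_ge // bar_x_comm.
have ne : (i, j) != (j, i) by rewrite xpair_eqE negb_and ij.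
rewrite (sum_two_entries ne) /= => [|k l k1 k2]; last by rewrite Rhat0.
rewrite Rhat_direct // Rhat_swap //.
have ji : j != i by rewrite eq_sym.
have w1 (u v : 'I_N) : wt (fun k => wt_eps i k + wt_eps j k) (x i u * x j v).
  exact: wtM (wt_x i u) (wt_x j v).
have w2 (u v : 'I_N) : wt (fun k => wt_eps i k + wt_eps j k) (x j u * x i v).
  by apply: wt_ext (wtM (wt_x j u) (wt_x i v)) => k; rewrite addrC.
set w := fun k : 'I_n => _ in w1 w2.
have wij : w i = w j by rewrite /w /wt_eps !eqxx (negbTE ij) (negbTE ji).
have [sq sq2] := hshift_Rhat ij wij; set q := rinv (h i j) in sq sq2 *.
have [ij'|ji'|/val_inj e] := ltngtP i j; last by rewrite e eqxx in ij.
- rewrite (dia_xx_lt a b ij') (dia_xx_lt b a ij') (dia_xx_ge b a (ltnW ij')).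
  rewrite (lact_wt _ (wtD (w1 b a) (wt_mulO iotaP _ (w2 b a)))) (lact_wt _ (w2 b a)).
  rewrite sq sq2 -clsD mulrDl O_prod [x j b * _]bar_x_comm [x i b * _]bar_x_comm.
  rewrite -/q -addrA O_sum; have -> : q * q + (1 - q * q) = 1 by ring.
  by rewrite (algmap1 OP) mulr1 addrC.
- rewrite (dia_xx_lt b a ji') (dia_xx_ge a b (ltnW ji')) (dia_xx_ge b a (ltnW ji')) lact1.
  rewrite (lact_wt _ (w1 b a)) sq.
  rewrite -clsD htdVN // -/q [x j b * _]bar_x_comm [x i b * _]bar_x_comm.
  by rewrite addrC -addrA O_sum addNr (algmap0 OP) mulr0 addr0.
Qed.

(** By [varphi_swap] the two orders of [dual_coeff] differ by 1 - q^2. For i < j this factor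
    accounts for the swapped entry; for i > j, where that entry is 1, it compensates the q^2 of the
    iterated correction. *)
Lemma relation_dd (i j : 'I_n) a b : dia (dbar i a) (dbar j b) =
  \sum_(k < n) \sum_(l < n) lact (Rhat F l k j i) (dia (dbar k b) (dbar l a)).
Proof.
have [<-|ij] := eqVneq i j.
  rewrite (sum_entry (p := (i, i))) /= => [|k l kl]; last first.
    by rewrite Rhat0 // !xpair_eqE ![i == _]eq_sym // andbC.
  by rewrite Rhat_diag lact1 !dia_dd_le // bar_d_comm.
have ne : (i, j) != (j, i) by rewrite xpair_eqE negb_and ij.
rewrite (sum_two_entries ne) /= => [|k l k1 k2]; last first.
  rewrite Rhat0 // !xpair_eqE ![_ == k]eq_sym ![_ == l]eq_sym //.
  by rewrite andbC.
have ji : j != i by rewrite eq_sym.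
rewrite Rhat_direct // Rhat_swap // [rinv (h j i)]htdVN //.
have w1 (u v : 'I_N) : wt (fun k => - wt_eps i k - wt_eps j k) (d i u * d j v).
  exact: wtM (wt_d i u) (wt_d j v).
have w2 (u v : 'I_N) : wt (fun k => - wt_eps i k - wt_eps j k) (d j u * d i v).
  by apply: wt_ext (wtM (wt_d j u) (wt_d i v)) => k; rewrite addrC.
set w := fun k : 'I_n => _ in w1 w2.
have wij : w i = w j by rewrite /w /wt_eps !eqxx (negbTE ij) (negbTE ji) addrC.
have [sq sq2] := hshift_Rhat ij wij.
have hq := htdV F ij; set q := rinv (h i j) in sq sq2 hq *.
have sNq : hshift w (- q) = - q by rewrite (algmapN (@hshift_algmap F n w)) sq.
have [ij'|ji'|/val_inj e] := ltngtP i j; last by rewrite e eqxx in ij.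
- have p12 : dual_coeff i j = dual_coeff j i * (1 - q * q).
    transitivity (dual_coeff i j * h i j ^+ 2 * q ^+ 2).
      by rewrite -mulrA -exprMn hq expr1n mulr1.
    rewrite varphi_swap // -/(dual_coeff j i) -mulrA; congr (_ * _).
    transitivity ((h i j * q) * (h i j * q) - q * q); first by rewrite /q; ring.
    by rewrite hq mulr1.
  rewrite (dia_dd_le a b (ltnW ij')) (dia_dd_le b a (ltnW ij')) (dia_dd_gt b a ij').
  rewrite (lact_wt _ (wt_mulO iotaP _ (w1 b a))).
  rewrite (lact_wt _ (wt_mulO iotaP _ (wtD (w2 b a) (wt_mulO iotaP _ (w1 b a))))).
  rewrite sNq sq2 -clsD -/q [d j b * _]bar_d_comm !O_prod [in RHS]mulrDl O_prod.
  rewrite addrCA O_sum -p12 (_ : dual_coeff i j * - q + q * dual_coeff i j = 0).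
    by rewrite (algmap0 OP) mulr0 addr0.
  by rewrite mulrN [q * _]mulrC addNr.
- have p21 : dual_coeff j i = dual_coeff i j * (1 - q * q).
    transitivity (dual_coeff j i * h j i ^+ 2 * q ^+ 2).
      by rewrite -mulrA -exprMn htdN mulNr sqrrN hq expr1n mulr1.
    rewrite varphi_swap // -/(dual_coeff i j) htdN -mulrA; congr (_ * _).
    transitivity ((h i j * q) * (h i j * q) - q * q); first by rewrite /q; ring.
    by rewrite hq mulr1.
  rewrite (dia_dd_gt a b ji') (dia_dd_gt b a ji') (dia_dd_le b a (ltnW ji')) lact1.
  rewrite (lact_wt _ (wt_mulO iotaP _ (wtD (w1 b a) (wt_mulO iotaP _ (w2 b a))))).
  rewrite sNq htdVN // -/q -clsD [d j b * _]bar_d_comm [d i b * _]bar_d_comm.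
  rewrite p21 !mulrDl !O_prod -addrA O_sum addrC; congr (cls (_ + _ * O _)).
    by congr (_ * O _); ring.
  by rewrite /q; ring.
Qed.

(** Both sides are expanded in the ordinary products with equal indices m. By partial fractions the
    d_m x_m get the same coefficients on the right as the x_m d_m on the left, namely the
    differences of consecutive [upper_prod]. Exchanging d_m and x_m leaves the sum of these
    coefficients, which telescopes to 1, times the delta of the upper indices. *)
Lemma relation_xd_diag (i : 'I_n) a b : dia (dhx F i a) (dbar i b) =
  \sum_(k < n) \sum_(l < n)
    lact (shift (@eps F n k) (Rhat F k i l i)) (dia (dbar k b) (dhx F l a))
  - dh1 F n N *+ (a == b).
Proof.
have inner k : \sum_(l < n)
      lact (shift (@eps F n k) (Rhat F k i l i)) (dia (dbar k b) (dhx F l a))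
    = lact (rinv (h k i + 1)) (dia (dbar k b) (dhx F k a)).
  have SP := @hshift_algmap F n (wt_eps k).
  rewrite (bigD1 k) //= big1 ?addr0 => [|l /negbTE lk].
    rewrite shift_eps -/(wt_eps k); congr lact.
    (* For k = i the entry is 1, which is also 1/(h~_ii + 1), so one formula covers all k. *)
    have [->|ki] := eqVneq k i.
      rewrite Rhat_diag (algmap1 (hshift_algmap _)) htdxx add0r; apply/esym/rinv_uniq.
      exact: mulr1.
    rewrite Rhat_direct // hshift_rinv; last first.
      by rewrite -[htd _ _ _]addr0; apply: (htd_invertible F 0).
    by rewrite hshift_htd /wt_eps eqxx [i == k]eq_sym (negbTE ki).
  rewrite shift_eps Rhat0 ?(algmap0 SP) ?lact0 // xpair_eqE negb_and ?lk //.
  by rewrite -negb_and; apply: contraFN lk => /andP[/eqP->].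
rewrite (eq_bigr _ (fun k _ => inner k)) dia_xd_eq.
pose c k := rinv (h k i + 1); pose psi k := hshift (wt_eps k) (phi k).
(* The product d_m x_m has weight 0, so left coefficients pass to the right unshifted. *)
have wt0 m : wt (fun=> 0) (d m b * x m a).
  by apply: wt_ext (wtM (wt_d m b) (wt_x m a)) => k; rewrite addNr.
have outer k : lact (c k) (dia (dbar k b) (dhx F k a))
    = cls (\sum_m d m b * x m a * O (c k * (psi k * lower_eigen F k m))).
  rewrite dia_dx_eq (lact_wt (w := fun=> 0)); last first.
    by apply: wt_sum => m _; apply: (wt_mulO iotaP); apply: wt0.
  rewrite (hshift_id (w := fun=> 0)) // mulr_suml; congr cls; apply: eq_bigr => m _.
  by rewrite O_prod; congr (_ * O _); rewrite /psi; ring.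
rewrite (eq_bigr _ (fun k _ => outer k)) -cls_sum exchange_big /=.
have coeff m : \sum_k d m b * x m a * O (c k * (psi k * lower_eigen F k m))
    = x m a * d m b * O (upper_eigen F i m * phi i)
      + (a == b)%:R * O (upper_prod F i m.+1 - upper_prod F i m).
  rewrite -mulr_sumr -(algmap_sum OP).
  have -> : \sum_k c k * (psi k * lower_eigen F k m) = upper_prod F i m.+1 - upper_prod F i m.
    rewrite (eq_bigr (fun k => c k * (psi k * lower_prod F k m)
      - c k * (psi k * lower_prod F k m.+1))); last first.
      by move=> k _; rewrite /lower_eigen !mulrBr.
    rewrite sumrB !partial_fractions_htd; ring.
  by rewrite upper_eigen_varphi bar_d_bar_x eqxx /= mulrDl.
rewrite (eq_bigr _ (fun m _ => coeff m)) big_split /= clsD -mulr_sumr -(algmap_sum OP).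
have -> : \sum_(m < n) (upper_prod F i m.+1 - upper_prod F i m) = 1.
  rewrite -(big_mkord xpredT (fun m => upper_prod F i m.+1 - upper_prod F i m)).
  by rewrite telescope_sumr // upper_prod_n upper_prod0 // subr0.
have e : cls (a == b)%:R = dh1 F n N *+ (a == b).
  by case: (a == b); [rewrite !mulr1n | rewrite !mulr0n; exact: raddf0].
by rewrite (algmap1 OP) mulr1 e addrK.
Qed.

(** For i != j only the entry k = j, l = i is nonzero. If i < j it is 1, and h_i does not occur in
    varphi_j; if i > j, [varphi_cross] absorbs it. *)
Lemma relation_xd (i j : 'I_n) a b : dia (dhx F i a) (dbar j b) =
  \sum_(k < n) \sum_(l < n)
    lact (shift (@eps F n k) (Rhat F k i l j)) (dia (dbar k b) (dhx F l a))
  - dh1 F n N *+ ((a == b) && (i == j)).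
Proof.
have [<-|ij] := eqVneq i j.
  by rewrite andbT; apply: relation_xd_diag.
rewrite andbF mulr0n subr0.
have ji : j != i by rewrite eq_sym.
have SP k := @hshift_algmap F n (wt_eps k).
rewrite (sum_entry (p := (j, i))) /= => [|k l kl]; last first.
  rewrite shift_eps Rhat0 ?(algmap0 (SP k)) ?lact0 // xpair_eqE negb_and ?ji ?orbT //.
  by move: kl; rewrite xpair_eqE negb_and orbC [j == k]eq_sym.
rewrite shift_eps -/(wt_eps j) dia_xd_ne // dia_dx_ne // bar_d_bar_x (negbTE ij) addr0.
have wt_ji : wt (fun k => wt_eps i k - wt_eps j k) (x i a * d j b).
  exact: wtM (wt_x i a) (wt_d j b).
rewrite (lact_wt _ (wt_mulO iotaP _ wt_ji)) O_prod Rhat_swap //.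
case: ifP => [ji'|/negbT]; first by congr (cls (_ * O _)); rewrite [RHS]mulrC varphi_cross.
rewrite -leqNgt => ij'.
rewrite (algmap1 (SP j)) (algmap1 (@hshift_algmap F n _)) mulr1 hshift_varphi_fix // => k jk.
have ji' : (i < j)%N by rewrite ltn_neqAle ij' val_eqE ij.
by rewrite /wt_eps -!val_eqE /= !gtn_eqF // (leq_trans ji').
Qed.

End Relations.

Theorem proposition3p3 (R : realType) (n N : nat) (n_gt0 : (0 < n)%N)
    (N_gt0 : (0 < N)%N) (P : fseries R[i] n) (P_extremal : extremal_projector P) :
  let C := R[i] in
  let x := @dhx C n N in
  let dbar := @dhdbar C n N in
  let dia := @diamond C n _ (@diagonal C n N) P in
  forall (i j : 'I_n) (alpha beta : 'I_N),
  [/\ dia (x i alpha) (x j beta) =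
        \sum_(k < n) \sum_(l < n)
          lact (Rhat C i j k l) (dia (x k beta) (x l alpha)),
      dia (dbar i alpha) (dbar j beta) =
        \sum_(k < n) \sum_(l < n)
          lact (Rhat C l k j i) (dia (dbar k beta) (dbar l alpha))
    & dia (x i alpha) (dbar j beta) =
        \sum_(k < n) \sum_(l < n)
          lact (shift (eps k) (Rhat C k i l j)) (dia (dbar k beta) (x l alpha))
        - dh1 C n N *+ ((alpha == beta) && (i == j))].
Proof.
move=> C x dbar dia i j alpha beta; split.
- exact: relation_xx.
- exact: relation_dd.
- exact: relation_xd.
Qed.
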